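(* Let $s,t\in\mathbb N$, put $d=\gcd(s,t)$ and $m=\mathrm{lcm}(s,t)$, let $\sigma$ be an $s$-core and $\tau$ a $t$-core, and for $k\in\mathbb N$ let $$N_{\sigma,\tau}(k)=\#\{\lambda\in\mathcal C_{m}\ :\ \mathrm{core}_s\lambda=\sigma,\ \mathrm{core}_t\lambda=\tau,\ \ell(\lambda)\le k\}.$$ If $\mathrm{core}_d(\sigma)=\mathrm{core}_d(\tau)$, then there is a quasipolynomial $Q_{\sigma,\tau}(k)$ of degree $\frac1d(s-d)(t-d)$ and period $m$ such that $N_{\sigma,\tau}(k)=Q_{\sigma,\tau}(k)$ for all sufficiently large integers $k$. The leading coefficient of $Q_{\sigma,\tau}$ is $\left(V_{\frac sd,\frac td}\right)^d$.
   Context: A partition $\lambda=(a_1,\dots,a_\ell)$ is a weakly decreasing finite sequence of positive integers; $\ell(\lambda)=\ell$ is its length (the empty partition has length $0$). For $t\in\mathbb N$, a $t$-core is a partition whose Young diagram contains no hook of size (hooklength) $t$; $\mathcal C_t$ denotes the set of $t$-cores. For a partition $\lambda$, $\mathrm{core}_t\lambda$ is the $t$-core of $\lambda$: the partition obtained by successively removing rim hooks (border strips) of size $t$ from the Young diagram until none remain (independent of choices). For $a,b\in\mathbb N$, $V_{a,b}$ is the relative volume of the transportation polytope of real $b\times a$ matrices with nonnegative entries, all row sums equal to $a$ and all column sums equal to $b$. Relative volume: if $\mathcal P\subset\mathbb R^n$ is a polytope with integer vertices and dimension $e$, choose an affine isomorphism $T$ from the affine span of $\mathcal P$ onto $\mathbb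 R^e$ mapping the integer points of the affine span bijectively onto $\mathbb Z^e$; the relative volume is the volume of $T(\mathcal P)$. A function $Q:\mathbb N\to\mathbb Q$ is a quasipolynomial of period $p$ if for each $0\le i<p$ the function $n\mapsto Q(i+np)$ ($n\ge0$) is a polynomial $P_i$; its degree is the maximum degree of the $P_i$. ''The leading coefficient of $Q$ is $c$'' means each $P_i$ (for the stated period) has degree equal to that of $Q$ and leading coefficient $c$. *)

(* Defs.v *)
From HB Require Import structures.
From mathcomp Require Import all_boot all_order all_algebra.
From mathcomp Require Import all_classical all_reals all_analysis.

Set Implicit Arguments.
Unset Strict Implicit.
Unset Printing Implicit Defensive.

Import Order.TTheory GRing.Theory Num.Theory.

Definition is_partition (la : seq nat) : bool :=
  sorted geq la && all (fun x => 0 < x) la.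

Definition plength (la : seq nat) : nat := size la.

Definition in_diagram (la : seq nat) (c : nat * nat) : bool :=
  (c.1 < size la) && (c.2 < nth 0 la c.1).

Definition hook_length (la : seq nat) (i j : nat) : nat :=
  (nth 0 la i - j.+1) + count (fun x => j < x) (drop i.+1 la) + 1.

Definition is_core (t : nat) (la : seq nat) : Prop :=
  is_partition la /\
  forall i j, in_diagram la (i, j) -> hook_length la i j <> t.

Definition cell_adj (c d : nat * nat) : bool :=
  ((c.1 == d.1) && ((c.2 == d.2.+1) || (d.2 == c.2.+1))) ||
  ((c.2 == d.2) && ((c.1 == d.1.+1) || (d.1 == c.1.+1))).

Definition remove_rim_hook (t : nat) (la mu : seq nat) : Prop :=
  let S := fun c => in_diagram la c && ~~ in_diagram mu c in
  [/\ is_partition mu,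
      (forall i, nth 0 mu i <= nth 0 la i),
      sumn la = sumn mu + t,
      (forall c d, S c -> S d ->
         exists p : seq (nat * nat), [/\ all S p, path cell_adj c p & last c p = d])
    & (forall i j, ~ [/\ S (i, j), S (i.+1, j), S (i, j.+1) & S (i.+1, j.+1)])].

Inductive rim_reach (t : nat) : seq nat -> seq nat -> Prop :=
| rim_reach_refl la : rim_reach t la la
| rim_reach_step la mu nu :
    remove_rim_hook t la mu -> rim_reach t mu nu -> rim_reach t la nu.

Definition is_core_of (t : nat) (la sg : seq nat) : Prop :=
  rim_reach t la sg /\ is_core t sg.

Definition card_is (P : seq nat -> Prop) (q : rat) : Prop :=
  exists l : seq (seq nat),
    [/\ uniq l, (forall x, x \in l <-> P x) & ((size l)%:R = q)%R].

Section Volume.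
Variable R : realType.
Local Open Scope ring_scope.
Local Open Scope classical_set_scope.

(* Lebesgue volume of A \cap R^n, points of R^n being lists of length n;
   computed as the iterated integral (Fubini-Tonelli) of Lebesgue measure. *)
Fixpoint volume (n : nat) (A : set (seq R)) : \bar R :=
  match n with
  | 0 => (if `[< A [::] >] then 1 else 0)%E
  | n'.+1 => (\int[@lebesgue_measure R]_x volume n' [set s | A (x :: s)])%E
  end.

Definition transport_polytope (a b : nat) : set 'M[R]_(b, a) :=
  [set x | [/\ (forall i j, 0 <= x i j),
              (forall i, \sum_j x i j = a%:R)
            & (forall j, \sum_i x i j = b%:R)]].

(* the affine isomorphism T from the affine span onto R^((b-1)(a-1)):
   keep the entries x i j with i < b-1 and j < a-1 (the remaining entries
   are determined by the row/column sums); it maps the integer points of the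
   affine span bijectively onto Z^((b-1)(a-1)). *)
Definition transport_coords (a b : nat) (x : 'M[R]_(b, a)) : seq R :=
  flatten [seq [seq x i j | j <- enum 'I_a & (nat_of_ord j < a.-1)%N]
          | i <- enum 'I_b & (nat_of_ord i < b.-1)%N].

Definition Vtransport (a b : nat) : R :=
  fine (volume (b.-1 * a.-1)%N ((@transport_coords a b) @` (@transport_polytope a b))).

End Volume.

Definition quasipoly_lead (R : realType) (Q : nat -> rat) (p D : nat) (c : R) : Prop :=
  forall i, i < p ->
    exists P : {poly rat},
      [/\ size P = D.+1, ratr (lead_coef P) = c
        & forall n : nat, Q (i + n * p)%N = P.[n%:R]]%R.

(* Main.v *)
(* Put d = gcd(s, t), a = s/d, b = t/d, m = lcm(s, t). A partition with at most k
   parts is a set of k beads, removing a rim hook of size t moves a bead from x to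
   x - t, and the t-core is read off the numbers of beads in the classes modulo t.
   An m-core is determined by its m bead numbers. By the Chinese remainder theorem
   these form d nonnegative integer b x a matrices, one for each class modulo d, and
   prescribing the s-core and the t-core prescribes their column and row sums, which
   increase by b and a when k increases by m. So N(i + n m) is a product of d numbers
   F(n) of nonnegative integer matrices with row sums A_i + n a and column sums
   B_j + n b.

   F is eventually polynomial: for large n such a matrix is the sum of one for n - 1
   and a nonnegative integer matrix with row sums a and column sums b (a min-cut
   argument), so that F is the Hilbert function of a finitely generated graded set.
   Let V be the volume of the transportation polytope. For suitable A, B the number
   F(n) bounds V n^((a-1)(b-1)) from above, for others from below (cubes of side 1/n
   that meet, or lie in, the polytope), and adding a fixed matrix shows that two choices of A,
     B give functions F that
   differ by at most a bounded shift of n. Hence the degree and the leading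
   coefficient. *)
Require Import Defs.
From HB Require Import structures.
From mathcomp Require Import all_boot all_order all_algebra.
From mathcomp Require Import all_classical all_reals all_analysis.
From mathcomp Require Import measurable_realfun polyrcf zify ring lra.
Import Order.TTheory GRing.Theory Num.Theory.

Set Implicit Arguments.
Unset Strict Implicit.
Unset Printing Implicit Defensive.

(** * Cardinality of predicates *)

(** The volume enters only through two-sided bounds: they place [F] between [v (n - c)^D] and
    [v (n + c)^D], which fixes the degree and the leading coefficient once [F] is known to be
    eventually polynomial. Polynomiality is therefore proved by itself, by counting in down-sets of
    lists of naturals, with no reference to the polytope. The iterated integral over the polytope is
    never computed; monotonicity and the exact value on unions of grid cubes suffice.

    The condition on the d-cores is a balance condition: in each class modulo d the prescribed row
    sums and column sums have the same total, because [sigma] and [tau] have equally many beads in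
    that class. Without this balance no matrix has the prescribed margins.

    From the corner coordinates on, [a] and [b] stand for s/d - 1 and t/d - 1: the free entries form
    a [b] by [a] matrix, and the degree of each factor is [b * a]. *)

Definition hascard (T : eqType) (P : T -> Prop) (n : nat) :=
  exists l : seq T, [/\ uniq l, (forall x, x \in l <-> P x) & size l = n].

Lemma hascard_inj (T U : eqType) (P : T -> Prop) (Q : U -> Prop) (f : T -> U) n k :
  (forall x, P x -> Q (f x)) ->
  (forall x y, P x -> P y -> f x = f y -> x = y) ->
  hascard P n -> hascard Q k -> n <= k.
Proof.
move=> PQ finj [l [ul lP <-]] [r [ur rQ <-]].
rewrite -(size_map f); apply: uniq_leq_size.
  by rewrite map_inj_in_uniq // => x y /lP Px /lP Py; apply: finj.
by move=> _ /mapP[x /lP Px ->]; apply/rQ/PQ.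
Qed.

Lemma hascard_uniq (T : eqType) (P : T -> Prop) n k :
  hascard P n -> hascard P k -> n = k.
Proof.
by move=> Pn Pk; apply/eqP; rewrite eqn_leq; apply/andP; split;
  apply: (@hascard_inj _ _ P P id).
Qed.

Lemma hascard_image (T U : eqType) (P : T -> Prop) (Q : U -> Prop) (f : T -> U) n :
  (forall x, P x -> Q (f x)) ->
  (forall x y, P x -> P y -> f x = f y -> x = y) ->
  (forall y, Q y -> exists2 x, P x & f x = y) ->
  hascard P n -> hascard Q n.
Proof.
move=> PQ finj fsurj [l [ul lP <-]]; exists (map f l); split.
- by rewrite map_inj_in_uniq // => x y /lP Px /lP Py; apply: finj.
- move=> y; split=> [/mapP[x /lP Px ->]|/fsurj[x Px <-]]; first exact: PQ.
  by apply: map_f; apply/lP.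
- by rewrite size_map.
Qed.

Lemma hascard0 (T : eqType) (P : T -> Prop) : (forall x, ~ P x) -> hascard P 0.
Proof. by move=> nP; exists [::]; split=> // x; split=> // /nP. Qed.

Lemma hascard_preim (T U : eqType) (P : T -> Prop) (Q : U -> Prop) (f : T -> U) n :
  (forall x, P x -> Q (f x)) ->
  (forall x y, P x -> P y -> f x = f y -> x = y) ->
  (forall y, Q y -> exists2 x, P x & f x = y) ->
  hascard Q n -> hascard P n.
Proof.
move=> PQ finj fsurj Qn.
(* Choosing preimages needs a default value in [T]; it exists unless [Q] is empty. *)
have [[y0 /fsurj[x0 _ _]]|nQ] := pselect (exists y, Q y); last first.
  have -> : n = 0 by apply: hascard_uniq Qn _; apply: hascard0 => y Qy; apply: nQ; exists y.
  by apply: hascard0 => x Px; apply: nQ; exists (f x); apply: PQ.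
have [g gP] : {g : U -> T & forall y, Q y -> P (g y) /\ f (g y) = y}.
  apply: (@choice _ _ (fun y x => Q y -> P x /\ f x = y)) => y.
  have [Qy|nQy] := pselect (Q y); last by exists x0.
  by have [x Px fx] := fsurj _ Qy; exists x.
apply: (@hascard_image _ _ Q P g) Qn => [y /gP[]//|y z /gP[_ fy] /gP[_ fz] gyz|x Px].
  by rewrite -fy -fz gyz.
exists (f x); first exact: PQ.
by have [Pg fg] := gP _ (PQ _ Px); apply: finj.
Qed.

Lemma hascard_sub (T : choiceType) (P : T -> Prop) (l : seq T) :
  (forall x, P x -> x \in l) -> exists n, hascard P n.
Proof.
move=> Pl; exists (size [seq x <- undup l | `[< P x >]]).
exists [seq x <- undup l | `[< P x >]]; split=> //; first exact/filter_uniq/undup_uniq.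
move=> x; rewrite mem_filter mem_undup; split=> [/andP[/asboolP]//|Px].
by rewrite Pl // andbT; apply/asboolP.
Qed.

Lemma hascard_ext (T : eqType) (P Q : T -> Prop) n :
  (forall x, P x <-> Q x) -> hascard P n -> hascard Q n.
Proof.
by move=> PQ [l [ul lP sl]]; exists l; split=> // x; rewrite -PQ.
Qed.

Lemma hascard_or (T : eqType) (P Q : T -> Prop) n k :
  (forall x, P x -> Q x -> False) -> hascard P n -> hascard Q k ->
  hascard (fun x => P x \/ Q x) (n + k).
Proof.
move=> dPQ [l [ul lP <-]] [r [ur rQ <-]]; exists (l ++ r); split.
- rewrite cat_uniq ul ur andbT /=; apply/hasPn => x /rQ Qx.
  by apply/negP => /lP Px; apply: dPQ Px Qx.
- by move=> x; rewrite mem_cat; split=> [/orP[/lP|/rQ]|[/lP ->|/rQ ->]];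
    [left|right| |rewrite orbT].
- by rewrite size_cat.
Qed.

Lemma hascard_classes (T : eqType) (P : nat -> T -> Prop) (r : nat) (c : nat -> nat) :
  (forall i j x, P i x -> P j x -> i = j) ->
  (forall i, i < r -> hascard (P i) (c i)) ->
  hascard (fun x => exists2 i, i < r & P i x) (\sum_(i < r) c i).
Proof.
move=> dP; elim: r => [|r IH] cP.
  by rewrite big_ord0; apply: hascard0 => x [].
rewrite big_ord_recr /=.
have := hascard_or _ (IH (fun i ir => cP i (ltnW ir))) (cP r (ltnSn r)).
move=> H; apply: hascard_ext (H _) => [x|x [i ir Pi] Pr].
  split=> [[[i ir Pi]|Pr]|[i]]; [by exists i => //; lia|by exists r|].
  rewrite ltnS leq_eqVlt => /orP[/eqP->|ir Pi]; first by right.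
  by left; exists i.
by have := dP _ _ _ Pi Pr; lia.
Qed.

(* The lists are gathered in one finite type so that [card_family] applies. *)
Lemma hascard_family (T : choiceType) (d : nat) (P : 'I_d -> T -> Prop) (c : 'I_d -> nat) :
  (forall i, hascard (P i) (c i)) ->
  hascard (fun f : {ffun 'I_d -> T} => forall i, P i (f i)) (\prod_i c i).
Proof.
move=> /choice[l lP].
pose L := flatten [seq l i | i <- enum 'I_d].
have lL i x : x \in l i -> x \in L.
  by move=> xl; apply/flattenP; exists (l i) => //; apply: map_f; rewrite mem_enum.
pose F i := [pred x : seq_sub L | ssval x \in l i].
pose g (f : {ffun 'I_d -> seq_sub L}) := [ffun i => ssval (f i)] : {ffun 'I_d -> T}.
have ginj : injective g.
  move=> f1 f2 /ffunP eqg; apply/ffunP => i; apply: val_inj.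
  by have := eqg i; rewrite !ffunE.
exists (map g (enum (family F))); split.
- by rewrite map_inj_uniq // enum_uniq.
- move=> f; split.
    move=> /mapP[f' + ->] i; rewrite mem_enum => /familyP/(_ i).
    by rewrite inE ffunE; have [_ lPi _] := lP i => /lPi.
  move=> Pf; have fl i : f i \in l i by have [_ lPi _] := lP i; apply/lPi.
  apply/mapP; exists [ffun i => SeqSub (lL _ _ (fl i))].
    by rewrite mem_enum; apply/familyP => i; rewrite inE ffunE /=.
  by apply/ffunP => i; rewrite !ffunE.
- rewrite size_map -cardE card_family foldrE big_map enumT; apply: eq_bigr => i _.
  have [ul _ <-] := lP i.
  rewrite -(card_seq_sub ul) -!sum1_card.
  rewrite -[RHS](big_map (@ssval _ _) predT (fun=> 1)).
  rewrite -[LHS]big_filter -[LHS](big_map (@ssval _ _) predT (fun=> 1)).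
  apply: perm_big; apply: uniq_perm.
  + by rewrite map_inj_uniq ?filter_uniq ?index_enum_uniq //; apply: val_inj.
  + by rewrite map_inj_uniq ?index_enum_uniq //; apply: val_inj.
  move=> x; apply/mapP/mapP => -[y].
    by rewrite mem_filter => /andP[yl _] ->; exists (SeqSub yl) => //; rewrite mem_index_enum.
  by move=> _ ->; exists (SeqSub (lL _ _ (ssvalP y))) => //;
    rewrite mem_filter mem_index_enum andbT; exact: (ssvalP y).
Qed.

(** * Eventually polynomial functions and down-sets *)

Definition evpoly (f : nat -> nat) :=
  exists (p : {poly rat}) N, forall n, N <= n -> ((f n)%:R = p.[n%:R])%R.

(** Induction on the degree: with [k = size p], the difference of ['X^k / k] has leading term
    ['X^(k-1)], so a multiple of it cancels the top term of [p]. *)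
Lemma poly_antidiff (p : {poly rat}) : exists q : {poly rat}, (q \Po ('X + 1) - q = p)%R.
Proof.
have [n] := ubnP (size p); elim: n p => // n IH p; rewrite ltnS => pn.
have [->|p0] := eqVneq p 0%R; first by exists 0%R; rewrite comp_poly0 subrr.
have sp : 0 < size p by rewrite size_poly_gt0.
set k := size p in pn sp *.
pose q : {poly rat} := ((lead_coef p / k%:R) *: 'X^k)%R.
have kR : (k%:R != 0 :> rat)%R by rewrite pnatr_eq0 -lt0n.
have [|r rP] := IH (p - (q \Po ('X + 1) - q))%R; last first.
  by exists (q + r)%R; rewrite comp_polyD opprD addrACA rP addrC subrK.
apply: leq_trans pn; suff H : size (p - (q \Po ('X + 1) - q))%R <= k.-1 by rewrite (leq_ltn_trans
  H) // ltn_predL.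
apply/leq_sizeP => j jk.
rewrite /q comp_polyZ comp_Xn_poly -scalerBr exprDn.
rewrite coefB coefZ coefB coef_sum.
under eq_bigr => i _ do rewrite expr1n mulr1 coefMn coefXn.
rewrite coefXn.
have [kj|] := ltnP k j.
  rewrite big1 ?(gtn_eqF kj) ?subr0 ?mulr0 ?subr0.
    by rewrite nth_default // ltnW.
  move=> i _; have -> : (j == (k - i)%N) = false by have := ltn_ord i; lia.
  by rewrite mul0rn.
move=> {}kj.
have [jE|jE] : j = k \/ j = k.-1 by lia.
  rewrite jE eqxx big_ord_recl subn0 eqxx bin0 big1 ?addr0 ?mulr1n ?subrr ?mulr0 ?subr0.
    by rewrite nth_default.
  move=> i _; have -> : (k == (k - lift ord0 i)%N) = false.
    by have := ltn_ord i; rewrite /= /bump; lia.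
  by rewrite mul0rn.
rewrite jE.
have -> : (k.-1 == k) = false by lia.
have o1 : 1 < k.+1 by [].
rewrite (bigD1 (Ordinal o1)) //= big1 ?addr0.
  rewrite subn1 eqxx bin1 -[(true%:R *+ k)%R]/(k%:R)%R divfK // lead_coefE subrr //.
move=> i i1; have -> : (k.-1 == (k - i)%N) = false.
  have : (i : nat) != 1 by apply: contra i1 => /eqP i1; apply/eqP/val_inj.
  by have := ltn_ord i; lia.
by rewrite mul0rn.
Qed.

Lemma evpoly_eq f g N : (forall n, N <= n -> f n = g n) -> evpoly f -> evpoly g.
Proof.
move=> fg [p [M pM]]; exists p, (maxn N M) => n; rewrite geq_max => /andP[Nn Mn].
by rewrite -fg // pM.
Qed.

Lemma evpolyD f g : evpoly f -> evpoly g -> evpoly (fun n => f n + g n).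
Proof.
move=> [p [N pN]] [q [M qM]]; exists (p + q)%R, (maxn N M) => n.
by rewrite geq_max natrD hornerD => /andP[/pN -> /qM ->].
Qed.

Lemma evpoly0 : evpoly (fun=> 0).
Proof. by exists 0%R, 0 => n _; rewrite horner0. Qed.

Lemma evpoly_sum (r : nat) (f : nat -> nat -> nat) :
  (forall i, i < r -> evpoly (f i)) -> evpoly (fun n => \sum_(i < r) f i n).
Proof.
elim: r => [|r IH] fP.
  by apply: (@evpoly_eq (fun=> 0) _ 0) evpoly0 => n _; rewrite big_ord0.
apply: (@evpoly_eq (fun n => \sum_(i < r) f i n + f r n) _ 0) => [n _|].
  by rewrite big_ord_recr.
by apply: evpolyD; [apply: IH => i /ltnW; apply: fP|exact: fP].
Qed.

Lemma evpoly_shift f k : evpoly f -> evpoly (fun n => f (n + k)).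
Proof.
move=> [p [N pN]]; exists (p \Po ('X + (k%:R)%:P))%R, N => n Nn.
by rewrite horner_comp !hornerE -natrD pN // (leq_trans Nn) ?leq_addr.
Qed.

Lemma evpoly_unshift f k : evpoly (fun n => f (n + k)) -> evpoly f.
Proof.
move=> [p [N pN]]; exists (p \Po ('X - (k%:R)%:P))%R, (N + k) => n Nn.
rewrite horner_comp !hornerE -natrB ?(leq_trans _ Nn) ?leq_addl //.
by rewrite -pN ?subnK //; lia.
Qed.

Lemma evpoly_antidiff f g N :
  (forall n, N <= n -> f n.+1 = f n + g n) -> evpoly g -> evpoly f.
Proof.
move=> fg [p [M pM]]; have [q qp] := poly_antidiff p.
pose K := maxn N M.
exists (q + ((f K)%:R - q.[K%:R])%:P)%R, K => n Kn.
rewrite -(subnK Kn); elim: (n - K) => [|j IH]; first by rewrite add0n hornerD hornerC addrC subrK.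
rewrite addSn fg; last by rewrite (leq_trans (leq_maxl N M)) ?leq_addl.
rewrite natrD IH pM; last by rewrite (leq_trans (leq_maxr N M)) ?leq_addl.
rewrite -qp !(hornerD, hornerN, hornerC) horner_comp.
by rewrite hornerD hornerX hornerC natr1 addrC addrA subrK.
Qed.

Definition down_closed (D : seq nat -> Prop) :=
  forall u v, all2 leq u v -> D v -> D u.

(* Descending chains of down-sets of [nat^N] are stationary: the slices of the
   k-th set at height j decrease in both k and j, so those with j and k large
   agree with the limit of the diagonal chain. *)
Lemma down_closed_dcc N (D : nat -> seq nat -> Prop) :
  (forall k, down_closed (D k)) ->
  (forall k u, D k.+1 u -> D k u) ->
  exists K, forall k u, K <= k -> size u = N -> (D k u <-> D K u).
Proof.
elim: N D => [|N IH] D dD decD.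
  have [[K nK]|H] := pselect (exists K, ~ D K [::]).
    exists K => k [|//] Kk _; split=> // Dk; exfalso; apply: nK.
    by elim: k Kk Dk => [|k IH]; [rewrite leqn0 => /eqP ->|
      rewrite leq_eqVlt ltnS => /orP[/eqP -> //|/IH H /decD]].
  have DT k : D k [::] by have [//|n] := pselect (D k [::]); case: H; exists k.
  by exists 0 => k [|//] _ _; split.
have mono k j u : k <= j -> D j u -> D k u.
  by elim: j => [|j IHj]; [rewrite leqn0 => /eqP ->|
    rewrite leq_eqVlt ltnS => /orP[/eqP -> //|/IHj H /decD]].
have monoh k j i u : i <= j -> D k (j :: u) -> D k (i :: u).
  move=> ij; apply: dD => /=; rewrite ij /=.
  by elim: u => //= x u ->; rewrite leqnn.
have dslice k j : down_closed (fun u => D k (j :: u)).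
  by move=> u v uv; apply: dD; rewrite /= leqnn.
have [K0 K0P] := IH (fun k u => D k (k :: u)) (fun k => dslice k k)
  (fun k u H => monoh _ _ _ _ (leqnSn k) (decD _ _ H)).
have /choice[K1 K1P] j := IH (fun k u => D k (j :: u)) (fun k => dslice k j)
  (fun k u => decD k _).
pose K := maxn K0 (\max_(j < K0) K1 j).
exists K => k [//|j u] Kk [su]; split; first exact: mono.
have K0K : K0 <= K by exact: leq_maxl.
have [jK0|K0j] := ltnP j K0.
  have K1K : K1 j <= K.
    by rewrite leq_max; apply/orP; right; apply: (leq_bigmax (Ordinal jK0)).
  by move=> /(K1P j K u K1K su) /(K1P j k u (leq_trans K1K Kk) su).
move=> /(mono _ _ _ K0K) /(monoh _ _ _ _ K0j) H.
apply: (@mono k (maxn k j)); first exact: leq_maxl.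
apply: (@monoh _ (maxn k j)); first exact: leq_maxr.
by apply/(K0P (maxn k j) u _ su) => //; rewrite leq_max K0j orbT.
Qed.

(** By [down_closed_dcc] the slices at first coordinate k are constant from some [K] on. The outer
    induction is on the number of coordinates, the inner one on [K]: splitting off slice 0 and
    lowering the first coordinate by one lowers [K]. When [K] is 0 all slices agree, and the count
    is a partial sum of the count for one slice. *)
Lemma down_closed_evpoly N (D : seq nat -> Prop) : down_closed D ->
  exists2 f, (forall n, hascard (fun u => [/\ size u = N, sumn u = n & D u]) (f n))
    & evpoly f.
Proof.
elim: N D => [|N IH] D dD.
  exists (fun n => ((n == 0) && `[< D [::] >] : nat)); last first.
    by apply: (@evpoly_eq (fun=> 0) _ 1) evpoly0 => -[].
  case=> [|n]; last by apply: hascard0 => -[|x u] [].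
  case: asboolP => /= H; last by apply: hascard0 => u [/size0nil -> _ /H].
  by exists [:: [::]]; split=> // u; rewrite inE; split=> [/eqP ->|[/size0nil ->]].
have dslice D' j : down_closed D' -> down_closed (fun u => D' (j :: u)).
  by move=> dD' u v uv; apply: dD'; rewrite /= leqnn.
have dshift D' : down_closed D' -> down_closed (fun u =>
  if u is x :: v then D' (x.+1 :: v) else False).
  by move=> dD' [|x u] [|y v] //= /andP[xy uv]; apply: dD'; rewrite /= ltnS xy.
have leh D' j u : down_closed D' -> D' (j.+1 :: u) -> D' (j :: u).
  move=> dD'; apply: dD' => /=; rewrite leqnSn /=.
  by elim: u => //= x u ->; rewrite leqnn.
have step D' f0 f1 n : (forall n, hascard (fun u => [/\ size u = N,
  sumn u = n & D' (0 :: u)]) (f0 n)) ->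
    hascard (fun u => [/\ size u = N.+1, sumn u = n &
      if u is x :: v then D' (x.+1 :: v) else False]) f1 ->
    hascard (fun u => [/\ size u = N.+1, sumn u = n.+1 & D' u]) (f0 n.+1 + f1).
  move=> f0P f1P.
  have H0 : hascard (fun u => exists2 v, u = 0 :: v & [/\ size v = N,
    sumn v = n.+1 & D' (0 :: v)]) (f0 n.+1).
    by apply: (@hascard_image _ _ _ _ (cons 0)) (f0P n.+1) => [v H|u v _ _ [->]|_ [v -> H]] //;
      exists v.
  have H1 : hascard (fun u => exists x v, [/\ u = x.+1 :: v, size v = N, x + sumn v = n & D' u]) f1.
    apply: (@hascard_image _ _ _ _ (fun u => (head 0 u).+1 :: behead u)) f1P.
    - by move=> [|x v] [] //= [sv] sm H; exists x, v.
    - by move=> [|x u] [|y v] [] // _ _ _ [] //= _ _ _ [-> ->].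
    - by move=> _ [x [v [-> sv sm H]]]; exists (x :: v) => //=; rewrite sv sm.
  apply: hascard_ext (hascard_or _ H0 H1) => [u|u [v -> _] [x [w []]]//].
  split=> [[[v -> [sv sm H]]|[x [v [-> sv sm H]]]]|]; first by rewrite /= sv sm.
    by rewrite /= sv -sm addSn.
  case: u => [|[|x] v] [] //= [sv] sm H; [left; exists v|right; exists x, v] => //.
  by split=> //; move: sm; rewrite addSn => -[].
have base D' f0 : (forall n, hascard (fun u => [/\ size u = N, sumn u = n & D' (0 :: u)]) (f0 n)) ->
    hascard (fun u => [/\ size u = N.+1, sumn u = 0 & D' u]) (f0 0).
  move=> f0P; apply: (@hascard_image _ _ _ _ (cons 0)) (f0P 0).
  - by move=> u [su sm H]; split; [rewrite /= su|exact: sm|exact: H].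
  - by move=> u v _ _ [].
  - move=> [|x v] [] //= [sv] /eqP; rewrite addn_eq0 => /andP[/eqP-> /eqP sm] H.
    by exists v.
have [K] := down_closed_dcc N (fun k => dslice D k dD) (fun k u => leh D k u dD).
elim: K D dD => [|K IHK] D dD DK.
  have [f0 f0P evf0] := IH _ (dslice D 0 dD).
  exists (fun n => \sum_(i < n.+1) f0 i); last first.
    apply: (@evpoly_antidiff _ (fun n => f0 (n + 1)) 0) => [n _|].
      by rewrite big_ord_recr addn1.
    exact: evpoly_shift.
  elim=> [|n IHn]; first by rewrite big_ord1; apply: base.
  rewrite big_ord_recr /= addnC; apply: step => //.
  apply: hascard_ext IHn => -[|x u]; first by split=> -[].
  split=> -[[su] sm]; have H1 := DK x u (leq0n _) su; have H2 := DK x.+1 u (leq0n _) su.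
    by move=> /H1/H2; split=> //=; rewrite su.
  by move=> /H2/H1; split=> //=; rewrite su.
have [f0 f0P evf0] := IH _ (dslice D 0 dD).
have [|f1 f1P evf1] := IHK _ (dshift D dD).
  by move=> k u Kk su; apply: (iff_trans (DK k.+1 u _ su)) => //; exact: iff_refl.
exists (fun n => f0 n + (if n is n'.+1 then f1 n' else 0)).
  by case=> [|n]; [rewrite addn0; apply: base|apply: step].
apply: evpolyD => //; apply: (@evpoly_unshift _ 1).
by apply: (@evpoly_eq f1 _ 0) => // n _; rewrite addn1.
Qed.

(** * Hilbert functions of graded sets *)

Fixpoint addl (u v : seq nat) : seq nat :=
  match u, v with x :: u', y :: v' => x + y :: addl u' v' | _, _ => [::] end.

Fixpoint lexlt (u v : seq nat) : bool :=
  match u, v with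
  | x :: u', y :: v' => (x < y) || (x == y) && lexlt u' v'
  | _, _ => false
  end.

Fixpoint combo (T : nmodType) (g : seq T) (u : seq nat) : T :=
  match g, u with y :: g', k :: u' => (y *+ k + combo g' u')%R | _, _ => 0%R end.

Lemma size_addl u v : size u = size v -> size (addl u v) = size u.
Proof. by elim: u v => [|x u IH] [|y v] //= [/IH ->]. Qed.

Lemma sumn_addl u v : size u = size v -> sumn (addl u v) = sumn u + sumn v.
Proof. by elim: u v => [|x u IH] [|y v] //= [/IH ->]; rewrite addnACA. Qed.

Lemma all2_leq_addl u v : all2 leq u v -> exists2 w, size w = size u & v = addl u w.
Proof.
elim: u v => [|x u IH] [|y v] //=; first by exists [::].
by move=> /andP[xy /IH[w sw ->]]; exists (y - x :: w); rewrite /= ?sw ?subnKC.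
Qed.

Lemma lexlt_addl u v w : size u = size v -> size w = size u ->
  lexlt u v -> lexlt (addl u w) (addl v w).
Proof.
elim: u v w => [|x u IH] [|y v] [|z w] //= [suv] [swu].
by rewrite ltn_add2r eqn_add2r => /orP[->//|/andP[-> /IH ->//]]; rewrite orbT.
Qed.

Lemma lexlt_total u v : size u = size v -> u <> v -> lexlt u v || lexlt v u.
Proof.
elim: u v => [|x u IH] [|y v] //= [suv] uv.
case: ltngtP => //= xy; rewrite -?xy ?ltnn ?eqxx /= IH // => E.
by apply: uv; rewrite xy E.
Qed.

(** On lists of a fixed length the order is well founded: minimise the head, then the tail among
    lists with that head. *)
Lemma lexlt_min N (S : seq nat -> Prop) u : S u -> size u = N ->
  exists v, [/\ S v, size v = N & forall w, S w -> size w = N -> ~~ lexlt w v].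
Proof.
elim: N S u => [|N IH] S u Su su.
  by exists u; split=> // w _ _; move: su; case: u {Su} => // _; case: w.
pose p x := `[< exists2 v, size v = N & S (x :: v) >].
have exp : exists x, p x.
  by case: u Su su => // x u Su [su]; exists x; apply/asboolP; exists u.
have [x /asboolP[v sv Sv] xmin] := ex_minnP exp.
have [w [Sw sw wmin]] := IH (fun w => S (x :: w)) v Sv sv.
exists (x :: w); split=> // [|[|y z] //= Sz [sz]]; first by rewrite /= sw.
have xy : x <= y by apply: xmin; apply/asboolP; exists z.
rewrite negb_or -leqNgt xy negb_and /=.
by have [yx|//] := eqVneq y x; rewrite yx in Sz; exact: wmin.
Qed.

Lemma combo_addl (T : nmodType) (g : seq T) u v :
  size u = size g -> size v = size g ->
  combo g (addl u v) = (combo g u + combo g v)%R.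
Proof.
elim: g u v => [|y g IH] [|x u] [|z v] //=; first by rewrite addr0.
by move=> [su] [sv]; rewrite IH // mulrnDr addrACA.
Qed.

Lemma combo_incr_nth (T : nmodType) (g : seq T) u j : size u = size g -> j < size g ->
  combo g (incr_nth u j) = (combo g u + nth 0%R g j)%R.
Proof.
elim: g u j => [|y g IH] [|x u] [|j] //= [su]; rewrite ?ltnS => jg.
  by rewrite mulrS -addrA addrC.
by rewrite IH // addrA.
Qed.

Lemma sumn_incr_nth u j : sumn (incr_nth u j) = (sumn u).+1.
Proof.
elim: j u => [|j IH] [|x u] //=; last by rewrite IH addnS.
by rewrite sumn_ncons.
Qed.

Lemma combo_sumn0 (T : nmodType) (g : seq T) u : sumn u = 0 -> combo g u = 0%R.
Proof.
elim: g u => [|y g IH] [|x u] //= /eqP; rewrite addn_eq0 => /andP[/eqP -> /eqP/IH ->].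
by rewrite addr0.
Qed.

(* Hilbert's theorem for the graded set [X]: each element of degree n0 + n is
   [x_i + combo g u] with [x_i] of degree n0 and [sumn u = n]; keeping the least
   i, then the lexicographically least u, gives each element once, and for fixed
   i the retained u form a down-set. *)
Theorem generated_evpoly (T : nmodType) (g : seq T) (X : nat -> T -> Prop) n0 f :
  (forall n, hascard (X n) (f n)) ->
  (forall n x y, y \in g -> X n x -> X n.+1 (x + y)%R) ->
  (forall n z, n0 <= n -> X n.+1 z -> exists x y, [/\ X n x, y \in g & z = (x + y)%R]) ->
  evpoly f.
Proof.
move=> fX addX genX; set N := size g.
have addXn m h k y : y \in g -> X m h -> X (m + k) (h + y *+ k)%R.
  move=> yg Xmh; elim: k => [|k IH]; first by rewrite addn0 addr0.
  by rewrite addnS mulrSr addrA; apply: addX.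
have combo_closed m h u : size u = N -> X m h -> X (m + sumn u) (h + combo g u)%R.
  have : {subset g <= g} by [].
  rewrite {}/N; elim: {1 3 4}g u m h => [|y g' IH] [|k u] m h //= sub su Xh.
    by rewrite addr0 addn0.
  rewrite addnA addrA; apply: IH => [z zg'| |]; last by apply: addXn => //; apply: sub;
    rewrite mem_head.
    by apply: sub; rewrite inE zg' orbT.
  by case: su.
have [l [_ lX _]] := fX n0.
pose x i := nth 0%R l i.
pose rep n z i u := [/\ size u = N, sumn u = n & z = (x i + combo g u)%R].
have rep_sound n z i u : i < size l -> rep n z i u -> X (n + n0) z.
  move=> il [su <- ->]; rewrite addnC; apply: combo_closed => //.
  by apply/lX/mem_nth.
have rep_complete n z : X (n + n0) z -> exists2 i, i < size l & exists u, rep n z i u.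
  elim: n z => [|n IH] z.
    rewrite add0n => /lX zl; exists (index z l); first by rewrite index_mem.
    exists (nseq N 0); split; rewrite ?size_nseq ?sumn_nseq //.
    by rewrite combo_sumn0 ?sumn_nseq // addr0 /x nth_index.
  rewrite addSn => /(genX _ _ (leq_addl _ _))[h [y [/IH[i il [u [su sn ->]]] yg ->]]].
  have jg : index y g < size g by rewrite index_mem.
  exists i => //; exists (incr_nth u (index y g)); split.
  - by rewrite size_incr_nth su jg.
  - by rewrite sumn_incr_nth sn.
  - by rewrite combo_incr_nth // addrA nth_index.
pose D i u := size u = N -> forall v, size v = N -> sumn v = sumn u ->
  (forall j, j < i -> (x j + combo g v)%R <> (x i + combo g u)%R) /\
  ((x i + combo g v)%R = (x i + combo g u)%R -> ~~ lexlt v u).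
(* A competitor of [u] of the same degree, translated by [w'], competes with [addl u w']; equality
   of values and lexicographic order both survive the translation. *)
have dD i : down_closed (D i).
  move=> u w uw; have [w' sw' ->] := all2_leq_addl uw => Dw su v sv svu.
  have [] := Dw _ (addl v w').
  - by rewrite size_addl ?sw'.
  - by rewrite size_addl ?sw' ?su.
  - by rewrite !sumn_addl ?sw' ?su // svu.
  rewrite !combo_addl ?sw' ?su // => Dj Di; split=> [j ji E|E].
    by apply: (Dj _ ji); rewrite !addrA E.
  apply: contra (Di _) => [|]; last by rewrite !addrA E.
  by apply: lexlt_addl; rewrite ?sv ?sw' ?su.
have /choice[c cP] i : exists c : nat -> nat,
    (forall n, hascard (fun u => [/\ size u = N, sumn u = n & D i u]) (c n)) /\ evpoly c.
  by have [c cP evc] := down_closed_evpoly N (dD i); exists c.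
apply: (@evpoly_unshift _ n0).
apply: (@evpoly_eq (fun n => \sum_(i < size l) c i n) _ 0) => [n _|]; last first.
  by apply: evpoly_sum => i _; have [_] := cP i.
apply: hascard_uniq (fX _).
pose P i z := exists2 u, rep n z i u & D i u.
have Pdisj i j z : P i z -> P j z -> i = j.
  move=> [u [su sun zu] Du] [v [sv svn zv] Dv].
  have E : (x i + combo g u = x j + combo g v)%R by rewrite -zu.
  have [ij|ji|//] := ltngtP i j.
    by have [/(_ _ ij)] := Dv sv _ su (etrans sun (esym svn)).
  by have [/(_ _ ji)] := Du su _ sv (etrans svn (esym sun)); rewrite -E.
have Pcard i : i < size l -> hascard (P i) (c i n).
  move=> il; have [/(_ n) cin _] := cP i.
  apply: (@hascard_image _ _ _ _ (fun u => (x i + combo g u)%R)) cin.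
  - by move=> u [su sun Du]; exists u.
  - move=> u v [su sun Du] [sv svn Dv] E.
    have [//|uv] := pselect (u = v).
    have := lexlt_total (etrans su (esym sv)) uv.
    have [_ /(_ E)/negbTE ->] := Dv sv _ su (etrans sun (esym svn)).
    by have [_ /(_ (esym E))/negbTE ->] := Du su _ sv (etrans svn (esym sun)).
  - by move=> z [u [su sun ->] Du]; exists u.
apply: hascard_ext (hascard_classes Pdisj Pcard) => z; split.
  by move=> [i il [u ru _]]; apply: rep_sound ru.
move=> /rep_complete[i0 i0l [u0 r0]].
pose p i := `[< i < size l /\ exists u, rep n z i u >].
have exp : exists i, p i by exists i0; apply/asboolP; split=> //; exists u0.
have [i /asboolP[il [u ru]] imin] := ex_minnP exp.
have [su _ _] := ru.
have [v [rv sv vmin]] := lexlt_min ru su.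
exists i => //; exists v => // _ w sw sww.
have [_ svn zv] := rv; split=> [j ji E|E].
  have: i <= j by apply: imin; apply/asboolP; split; [exact: ltn_trans il|exists w; split;
    rewrite ?sww ?E].
  by rewrite leqNgt ji.
by apply: vmin => //; split; rewrite ?sww ?E.
Qed.

(** * Transportation with capacities *)

Lemma sum_eq_of_le (I : finType) (f g : I -> nat) :
  (forall i, f i <= g i) -> \sum_i g i <= \sum_i f i -> forall i, f i = g i.
Proof.
move=> fg gf i; apply/eqP; rewrite eqn_leq fg /=.
move: gf; rewrite (bigD1 i) // [in X in _ <= X](bigD1 i) //= => H.
have := leq_sum (index_enum I) (fun j (_ : j != i) => fg j); lia.
Qed.

(** In the min-cut condition the supply of the rows [I] must be absorbed by the demand of the
    columns [J] or leave through these entries. *)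
Definition cut b a (x : 'M[nat]_(b, a)) (I : {set 'I_b}) (J : {set 'I_a}) :=
  \sum_i \sum_j x i j * ((i \in I) && (j \notin J)).

Definition mass n (r : 'I_n -> nat) (I : {set 'I_n}) := \sum_i r i * (i \in I).

Lemma mass_modular n (r : 'I_n -> nat) (I1 I2 : {set 'I_n}) :
  mass r (I1 :&: I2) + mass r (I1 :|: I2) = mass r I1 + mass r I2.
Proof.
rewrite /mass -!big_split; apply: eq_bigr => i _ /=; rewrite !inE -!mulnDr.
by case: (i \in I1); case: (i \in I2).
Qed.

Lemma cut_submodular b a (x : 'M[nat]_(b, a)) I1 J1 I2 J2 :
  cut x (I1 :&: I2) (J1 :&: J2) + cut x (I1 :|: I2) (J1 :|: J2) <= cut x I1 J1 + cut x I2 J2.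
Proof.
rewrite /cut -!big_split; apply: leq_sum => i _; rewrite -!big_split.
apply: leq_sum => j _ /=; rewrite !inE -!mulnDr leq_mul2l; apply/orP; right.
by case: (i \in I1); case: (i \in I2); case: (j \in J1); case: (j \in J2).
Qed.

Lemma mass_setD1 n (r : 'I_n -> nat) (I : {set 'I_n}) i :
  i \in I -> mass r I = r i + mass r (I :\ i).
Proof.
move=> iI; rewrite /mass (bigD1 i) //= iI muln1; congr addn.
rewrite [RHS](bigD1 i) //= !inE eqxx muln0 add0n.
by apply: eq_bigr => u ui; rewrite !inE ui.
Qed.

Lemma cut_setD1 b a (x : 'M[nat]_(b, a)) (I : {set 'I_b}) (J : {set 'I_a}) i :
  i \in I -> (forall j, 0 < x i j -> j \notin J) ->
  cut x I J = \sum_j x i j + cut x (I :\ i) J.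
Proof.
move=> iI iJ; rewrite /cut (bigD1 i) //= [in RHS](bigD1 i) //=.
rewrite [X in _ = _ + (X + _)]big1 => [|v _]; last by rewrite !inE eqxx muln0.
rewrite add0n; congr addn; apply: eq_bigr.
  by move=> v _; have [->//|xv] := posnP (x i v); rewrite iI iJ // muln1.
by move=> u ui; apply: eq_bigr => v _; rewrite !inE ui.
Qed.

Lemma cut_setU1 b a (x : 'M[nat]_(b, a)) (I : {set 'I_b}) (J : {set 'I_a}) j :
  j \notin J -> (forall i, 0 < x i j -> i \in I) ->
  cut x I J = \sum_i x i j + cut x I (j |: J).
Proof.
move=> jJ jI; rewrite /cut -big_split; apply: eq_bigr => u _ /=.
rewrite (bigD1 j) //= [in RHS](bigD1 j) //= !inE eqxx /= andbF muln0 add0n jJ andbT.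
congr addn; first by have [->//|xu] := posnP (x u j); rewrite jI // muln1.
by apply: eq_bigr => v vj; rewrite !inE (negbTE vj).
Qed.

(* A capacity matrix [x] that satisfies the cut condition and is minimal has each
   of its positive entries in a tight cut; tight cuts form a lattice, and the cuts
   obtained as meets (joins) bound the row (column) sums of [x] by [r] ([c]). *)
Lemma capacitated_transport b a (r : 'I_b -> nat) (c : 'I_a -> nat) (x : 'M[nat]_(b, a)) :
  \sum_i r i = \sum_j c j ->
  (forall I J, mass r I <= mass c J + cut x I J) ->
  exists g : 'M[nat]_(b, a), [/\ forall i j, g i j <= x i j, forall i, \sum_j g i j = r i
              & forall j, \sum_i g i j = c j].
Proof.
move=> rc; have [N] := ubnP (\sum_i \sum_j x i j); elim: N x => // N IH x xN cond.
pose tight I J := mass r I == mass c J + cut x I J.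
(* A positive entry that crosses no tight cut can be lowered by one without violating the cut
   condition; the induction is on the total capacity. *)
have [[[i j] [xij nt]]|alltight] := pselect (exists ij : 'I_b * 'I_a,
    0 < x ij.1 ij.2 /\ forall (I : {set 'I_b}) (J : {set 'I_a}),
      ij.1 \in I -> ij.2 \notin J -> ~~ tight I J).
  rewrite /= in xij nt; pose x' := (\matrix_(u,
    v) (x u v - ((u == i) && (v == j)))%N)%R : 'M[nat]_(b, a).
  have x'E u v : x u v = x' u v + ((u == i) && (v == j)).
    by rewrite mxE subnK //; case: eqP => [->|]; case: eqP => [->|].
  have cutE I J : cut x I J = cut x' I J + ((i \in I) && (j \notin J)).
    rewrite /cut (bigD1 i) //= [in RHS](bigD1 i) //= (bigD1 j) //= [in RHS](bigD1 j) //=.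
    rewrite [x i j]x'E !eqxx /=.
    rewrite (eq_bigr (fun v => x' i v * ((i \in I) && (v \notin J)))); last first.
      by move=> v /negbTE vj; rewrite x'E vj andbF addn0.
    rewrite (eq_bigr (fun u => \sum_v x' u v * ((u \in I) && (v \notin J)))); last first.
      by move=> u /negbTE ui; apply: eq_bigr => v _; rewrite x'E ui addn0.
    by rewrite mulnDl mul1n -!addnA; congr addn; rewrite addnC addnA.
  have [||g [gx gr gc]] := IH x'.
  - rewrite -ltnS; apply: leq_trans xN; rewrite ltnS (bigD1 i) //= [in X in _ <= X](bigD1 i) //=.
    rewrite (bigD1 j) //= [in X in _ <= X](bigD1 j) //= [x i j]x'E !eqxx /= addn1 !addSn ltnS.
    by rewrite leq_add ?leq_add // ?leq_sum // => u _; rewrite ?leq_sum // => *;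
      rewrite mxE leq_subr.
  - move=> I J; have := cond I J; rewrite cutE.
    case: (boolP (i \in I)) => iI; last by rewrite addn0.
    case: (boolP (j \notin J)) => jJ; last by rewrite addn0.
    by have := nt I J iI jJ; rewrite /tight cutE iI jJ /=; lia.
  - by exists g; split=> // u v; apply: leq_trans (gx u v) _; rewrite mxE leq_subr.
have tightP i j : 0 < x i j -> exists (I : {set 'I_b}) (J : {set 'I_a}), [/\ i \in I,
  j \notin J & tight I J].
  move=> xij; have [//|n] := pselect (exists (I : {set 'I_b}) (J : {set 'I_a}), [/\ i \in I,
    j \notin J & tight I J]).
  by case: alltight; exists (i, j); split=> // I J iI jJ; apply/negP => t; apply: n; exists I, J.
have tight_lattice I1 J1 I2 J2 : tight I1 J1 -> tight I2 J2 ->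
    tight (I1 :&: I2) (J1 :&: J2) /\ tight (I1 :|: I2) (J1 :|: J2).
  rewrite /tight => /eqP t1 /eqP t2.
  have := cond (I1 :&: I2) (J1 :&: J2); have := cond (I1 :|: I2) (J1 :|: J2).
  have := cut_submodular x I1 J1 I2 J2; have := mass_modular r I1 I2; have := mass_modular c J1 J2.
  by move=> *; split; apply/eqP; lia.
have rows i : \sum_j x i j <= r i.
  have [I [J [iI tIJ iJ]]] : exists (I : {set 'I_b}) (J : {set 'I_a}), [/\ i \in I,
    tight I J & forall j, 0 < x i j -> j \notin J].
    suff H (s : seq 'I_a) : exists (I : {set 'I_b}) (J : {set 'I_a}), [/\ i \in I,
      tight I J & forall j, j \in s -> 0 < x i j -> j \notin J].
      have [I [J [? ? H']]] := H (enum 'I_a); exists I, J; split=> // j; apply: H'.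
      by rewrite mem_enum.
    elim: s => [|j s [I [J [iI tIJ iJ]]]].
      exists [set: 'I_b], [set: 'I_a]; rewrite /tight /mass; split; rewrite ?inE //.
      rewrite (eq_bigr r) => [|u _]; last by rewrite inE muln1.
      rewrite (eq_bigr c) => [|u _]; last by rewrite inE muln1.
      by rewrite rc /cut [X in _ + X]big1 ?addn0 // => u _; rewrite big1 // => v _;
        rewrite !inE muln0.
    have [xj|xj] := posnP (x i j).
      exists I, J; split=> // v; rewrite inE => /orP[/eqP ->|]; last exact: iJ.
      by rewrite xj.
    have [I' [J' [iI' jJ' tIJ']]] := tightP i j xj.
    exists (I :&: I'), (J :&: J'); have [t _] := tight_lattice _ _ _ _ tIJ tIJ'.
    split; rewrite ?inE ?iI //.
    move=> v; rewrite !inE negb_and => /orP[/eqP -> _|vs xv]; first by rewrite jJ' orbT.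
    by rewrite iJ.
  (* Row [i] crosses the cut entirely, so comparing tightness at [I] with the cut condition at
     [I :\ i] leaves a row sum of at most [r i]. *)
  have := cond (I :\ i) J; move: tIJ => /eqP.
  rewrite (mass_setD1 _ iI) (cut_setD1 iI iJ).
  move: (mass r _) (mass c _) (cut _ _ _) (\sum_j _) (r i) => *; lia.
have cols j : \sum_i x i j <= c j.
  have [I [J [jJ tIJ jI]]] : exists (I : {set 'I_b}) (J : {set 'I_a}), [/\ j \notin J,
    tight I J & forall i, 0 < x i j -> i \in I].
    suff H (s : seq 'I_b) : exists (I : {set 'I_b}) (J : {set 'I_a}), [/\ j \notin J,
      tight I J & forall i, i \in s -> 0 < x i j -> i \in I].
      have [I [J [? ? H']]] := H (enum 'I_b); exists I, J; split=> // i; apply: H'.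
      by rewrite mem_enum.
    elim: s => [|i s [I [J [jJ tIJ jI]]]].
      exists finset.set0, finset.set0; rewrite /tight /mass; split; rewrite ?inE //.
      rewrite !big1 => [|u _|u _]; rewrite ?inE ?muln0 // /cut.
      by rewrite big1 // => u _; rewrite big1 // => v _; rewrite !inE muln0.
    have [xi|xi] := posnP (x i j).
      exists I, J; split=> // v; rewrite inE => /orP[/eqP ->|]; last exact: jI.
      by rewrite xi.
    have [I' [J' [iI' jJ' tIJ']]] := tightP i j xi.
    exists (I :|: I'), (J :|: J'); have [_ t] := tight_lattice _ _ _ _ tIJ tIJ'.
    split; rewrite ?inE ?negb_or ?jJ //.
    move=> v; rewrite !inE => /orP[/eqP -> _|vs xv]; first by rewrite iI' orbT.
    by rewrite jI.
  have := cond I (j |: J); move: tIJ => /eqP.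
  rewrite (mass_setD1 _ (setU11 j J)) setU1K // (cut_setU1 jJ jI).
  move: (mass r _) (mass c _) (cut _ _ _) (\sum_i _) (c j) => *; lia.
(* The cut of all rows against no column bounds the total from below, which turns the inequalities
   for rows and columns into equalities. *)
have tot : \sum_i r i <= \sum_i \sum_j x i j.
  have := cond [set: 'I_b] finset.set0; rewrite /mass /cut.
  rewrite (eq_bigr r) => [|u _]; last by rewrite inE muln1.
  rewrite [X in _ <= X + _]big1 => [|u _]; last by rewrite inE muln0.
  by rewrite add0n; congr (_ <= _); apply: eq_bigr => u _; apply: eq_bigr => v _;
    rewrite !inE muln1.
exists x; split=> //; first exact: sum_eq_of_le.
by apply: sum_eq_of_le => //; rewrite -rc exchange_big.
Qed.

(** * Counting matrices with given margins *)

(** The offsets are integers since the lower bound for the volume and the differences of two offsets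
    take negative values; [n] moves the margins along a ray. *)
Definition margins b a (A : 'I_b -> int) (B : 'I_a -> int) (n : nat) (x : 'M[nat]_(b, a)) : Prop :=
  (forall i, (\sum_j x i j)%N%:Z = A i + (n * a)%N%:Z)%R /\
  (forall j, (\sum_i x i j)%N%:Z = B j + (n * b)%N%:Z)%R.

Lemma sum_Posz (I : finType) (f : I ->
  nat) (P : pred I) : ((\sum_(i | P i) f i)%N%:Z = \sum_(i | P i) (f i)%:Z)%R.
Proof. exact: (big_morph Posz PoszD). Qed.

Lemma transport_exists b a (r : 'I_b -> nat) (c : 'I_a -> nat) :
  \sum_i r i = \sum_j c j ->
  exists g : 'M[nat]_(b, a), (forall i, \sum_j g i j = r i) /\ (forall j, \sum_i g i j = c j).
Proof.
(* With every capacity equal to the total, a single entry crossing the cut is enough; a cut crossed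
   by no entry has no rows or all columns. *)
move=> rc; pose x : 'M[nat]_(b, a) := (\matrix_(i, j) (\sum_i r i)%N)%R.
have [I J|g [_ gr gc]] := capacitated_transport (x := x) rc; last by exists g.
have mle n (h : 'I_n -> nat) K : mass h K <= \sum_i h i.
  by apply: leq_sum => i _; case: (i \in K); rewrite ?muln1 ?muln0.
have [I0|[i iI]] := set_0Vmem I.
  by rewrite /mass big1 // => i _; rewrite I0 inE muln0.
have [Jc0|[j]] := set_0Vmem (~: J)%SET.
  apply: leq_trans (mle _ _ _) _; rewrite rc -[X in X <= _]addn0 leq_add //.
  apply: leq_sum => j _; have : j \notin (~: J)%SET by rewrite Jc0 inE.
  by rewrite inE negbK => ->; rewrite muln1.
rewrite inE => jJ; apply: leq_trans (mle _ _ _) _; apply: leq_trans (leq_addl _ _).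
by rewrite /cut [X in _ <= X](bigD1 i) //= (bigD1 j) //= iI jJ mxE muln1 -addnA leq_addr.
Qed.

Lemma margins_hascard b a (A : 'I_b -> int) (B : 'I_a -> int) n :
  exists k, hascard (margins A B n) k.
Proof.
pose N := \sum_i `|(A i + (n * a)%N%:Z)%R|%N.
apply: (@hascard_sub _ _ [seq map_mx (@nat_of_ord N.+1) y | y <- enum {: 'M['I_N.+1]_(b,
  a)}]) => x [xA _].
apply/mapP; exists (map_mx inord x); first by rewrite mem_enum.
apply/matrixP => i j; rewrite !mxE inordK // ltnS.
have := xA i; rewrite (bigD1 j) //= => E.
by rewrite /N (bigD1 i) //= -E /=; lia.
Qed.

Lemma marginsD b a (A A' : 'I_b -> int) (B B' : 'I_a -> int) n n' (x y : 'M[nat]_(b, a)) :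
  margins A B n x -> margins A' B' n' y ->
  margins (fun i => A i + A' i)%R (fun j => B j + B' j)%R (n + n') (x + y)%R.
Proof.
move=> [xA xB] [yA yB]; split=> [i|j].
  rewrite (eq_bigr (fun j => x i j + y i j)) => [|j _]; last by rewrite mxE.
  by rewrite big_split /= PoszD xA yA; lia.
rewrite (eq_bigr (fun i => x i j + y i j)) => [|i _]; last by rewrite mxE.
by rewrite big_split /= PoszD xB yB; lia.
Qed.

Lemma marginsB b a (A : 'I_b -> int) (B : 'I_a -> int) n (x y : 'M[nat]_(b, a)) :
  margins A B n.+1 x -> margins (fun=> 0)%R (fun=> 0)%R 1 y ->
  (forall i j, y i j <= x i j) ->
  exists2 z, margins A B n z & x = (z + y)%R.
Proof.
move=> [xA xB] [yA yB] yx; pose z : 'M[nat]_(b, a) := (\matrix_(i, j) (x i j - y i j)%N)%R.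
have xE i j : x i j = z i j + y i j by rewrite mxE subnK.
exists z; last by apply/matrixP => i j; rewrite [RHS]mxE; exact: xE.
split=> [i|j].
  have := xA i; have := yA i; rewrite [in X in _ -> X](eq_bigr (fun j => z i j + y i j)) //.
  by rewrite big_split /= => ? ?; lia.
have := xB j; have := yB j; rewrite [in X in _ -> X](eq_bigr (fun i => z i j + y i j)) //.
by rewrite big_split /= => ? ?; lia.
Qed.

Lemma sum_mass_int n (A : 'I_n -> int) (I : {set 'I_n}) :
  (`|\sum_(i in I) A i| <= (\sum_i `|A i|%N)%N%:Z)%R.
Proof.
apply: le_trans (ler_norm_sum _ _ _) _; rewrite sum_Posz.
rewrite [X in (_ <= X)%R](bigID (mem I)) /= lerDl; exact: sumr_ge0.
Qed.

(** Only a cut with [#|I| * a - #|J| * b] at least 1 is in question. For the margins of [x] this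
    difference is multiplied by [n.+1] and perturbed by the offsets, at most [n] in all, so the
    entries of [x] across the cut still cover it once. *)
Lemma margins_decompose b a (A : 'I_b -> int) (B : 'I_a -> int) n x :
  \sum_i `|A i|%N + \sum_j `|B j|%N <= n ->
  margins A B n.+1 x ->
  exists2 y, margins (fun=> 0)%R (fun=> 0)%R 1 y & forall i j, y i j <= x i j.
Proof.
move=> nAB [xA xB].
have [||g [gx gr gc]] := @capacitated_transport b a (fun=> a) (fun=> b) x.
- by rewrite !sum_nat_const !card_ord mulnC.
- move=> I J.
  have massE n' m (K : {set 'I_n'}) : mass (fun=> m) K = #|K| * m.
    by rewrite /mass -sum_nat_const [RHS]big_mkcond; apply: eq_bigr => i _ /=; case: ifP => _;
      rewrite ?muln1 ?muln0.
  rewrite !massE.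
  have [|aIJ] := leqP (#|I| * a) (#|J| * b); first by move=> H; apply: leq_trans H (leq_addr _ _).
  have rowcut : \sum_(i in I) \sum_j x i j <= cut x I J + \sum_(j in J) \sum_i x i j.
    rewrite [X in _ + X]exchange_big [X in X <= _]big_mkcond -big_split; apply: leq_sum => i _ /=.
    case: ifP => // iI; rewrite [X in _ + X]big_mkcond -big_split; apply: leq_sum => j _ /=.
    by case: (j \in J); rewrite /= ?muln1 ?muln0 ?addn0.
  have rI : ((\sum_(i in I) \sum_j x i j)%N%:Z = \sum_(i in I) A i + (#|I| * (n.+1 * a))%N%:Z)%R.
    by rewrite sum_Posz (eq_bigr _ (fun i _ => xA i)) big_split /= sumr_const -mulr_natr mulrC natz.
  have cJ : ((\sum_(j in J) \sum_i x i j)%N%:Z = \sum_(j in J) B j + (#|J| * (n.+1 * b))%N%:Z)%R.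
    by rewrite sum_Posz (eq_bigr _ (fun i _ => xB i)) big_split /= sumr_const -mulr_natr mulrC natz.
  have := sum_mass_int A I; have := sum_mass_int B J.
  move: rI cJ; rewrite !(mulnCA _ n.+1).
  move: (\sum_(i in I) A i)%R (\sum_(j in J) B j)%R rowcut aIJ nAB.
  move: (\sum_(i in I) _) (\sum_(j in J) _) (cut _ _ _) (\sum_i _) (\sum_j _) (#|I| * a) (#|J| * b).
  by move=> *; nia.
exists g => //; split=> [i|j]; by rewrite ?gr ?gc add0r mul1n.
Qed.

Theorem margins_evpoly b a (A : 'I_b -> int) (B : 'I_a -> int) f :
  (forall n, hascard (margins A B n) (f n)) -> evpoly f.
Proof.
have [k [g [_ gP _]]] := @margins_hascard b a (fun=> 0)%R (fun=> 0)%R 1.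
move=> fP; apply: (@generated_evpoly _ g (margins A B) (\sum_i `|A i|%N + \sum_j `|B j|%N)) => //.
  move=> n x y /gP my mx; rewrite -addn1; have := marginsD mx my.
  by congr margins; apply/funext => i; rewrite addr0.
move=> n z nn0 mz; have [y my yz] := margins_decompose nn0 mz.
by have [x mx zE] := marginsB mz my yz; exists x, y; split=> //; apply/gP.
Qed.

Lemma margins_inhabited b a (A : 'I_b -> int) (B : 'I_a -> int) : 0 < a -> 0 < b ->
  (\sum_i A i = \sum_j B j)%R ->
  exists n0, forall n, n0 <= n -> exists x : 'M[nat]_(b, a), margins A B n x.
Proof.
move=> a0 b0 AB; exists (\sum_i `|A i|%N + \sum_j `|B j|%N) => n nn0.
have Ai i : (0 <= A i + (n * a)%N%:Z)%R.
  have : `|A i| <= n by apply: leq_trans nn0; rewrite (bigD1 i) //= -addnA leq_addr.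
  by move=> ?; nia.
have Bj j : (0 <= B j + (n * b)%N%:Z)%R.
  have : `|B j| <= n by apply: leq_trans nn0; rewrite [X in _ + X](bigD1 j) //= addnCA leq_addr.
  by move=> ?; nia.
have [|x [xr xc]] := @transport_exists b a (fun i => absz (A i + (n * a)%N%:Z)%R) (fun j =>
  absz (B j + (n * b)%N%:Z)%R).
  apply/eqP; rewrite -eqz_nat !sum_Posz.
  rewrite (eq_bigr (fun i => A i + (n * a)%N%:Z)%R) => [|i _]; last by rewrite gez0_abs.
  rewrite [X in _ == X](eq_bigr (fun i => B i + (n * b)%N%:Z)%R) => [|i _];
    last by rewrite gez0_abs.
  rewrite !big_split /= AB !sumr_const !card_ord -(mulr_natr _ b) -(mulr_natr _ a) !natz.
  by rewrite -!PoszM -!mulnA [b * a]mulnC.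
by exists x; split=> [i|j]; rewrite ?xr ?xc gez0_abs.
Qed.

Lemma margins_dominated b a (A A' : 'I_b -> int) (B B' : 'I_a -> int) : 0 < a -> 0 < b ->
  (\sum_i A i = \sum_j B j)%R -> (\sum_i A' i = \sum_j B' j)%R ->
  exists c, forall n u v, hascard (margins A B n) u -> hascard (margins A' B' (n + c)) v -> u <= v.
Proof.
move=> a0 b0 AB AB'.
have [|c /(_ c (leqnn c))[y my]] := @margins_inhabited b a (fun i => A' i - A i)%R (fun j =>
  B' j - B j)%R a0 b0.
  by rewrite !sumrB AB AB'.
exists c => n u v; apply: (@hascard_inj _ _ _ _ (fun x => x + y)%R) => [x mx|x x' _ _ /matrixP E].
  have := marginsD mx my.
  by congr margins; apply/funext => i; rewrite addrC subrK.
by apply/matrixP => i j; have := E i j; rewrite !mxE => /addIn.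
Qed.

(** * Volumes of grid sets *)

Lemma le_integral_sup (R : realType) (f g : R -> \bar R) :
  (forall x, (0 <= f x)%E) -> (forall x, (f x <= g x)%E) ->
  (\int[@lebesgue_measure R]_x f x <= \int[@lebesgue_measure R]_x g x)%E.
Proof.
move=> f0 fg; rewrite !ge0_integralTE //; last by move=> x; apply: le_trans (fg x).
by apply: le_ereal_sup => _ [h hf <-]; exists h => // x; apply: le_trans (fg x).
Qed.

Lemma volume_ge0 (R : realType) n (A : set (seq R)) : (0 <= volume n A)%E.
Proof.
by elim: n A => [|n IH] A /=; [case: ifP|apply: integral_ge0 => x _].
Qed.

(* Monotone even for non-measurable slices, since the integral of a nonnegative
   function is the supremum over the simple functions below it. *)
Lemma volume_mono (R : realType) n (A B : set (seq R)) :
  (A `<=` B)%classic -> (volume n A <= volume n B)%E.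
Proof.
elim: n A B => [|n IH] A B AB /=.
  case: asboolP => [/AB ?|_]; case: asboolP => // _; exact: lee01.
by apply: le_integral_sup => x; [exact: volume_ge0|apply: IH => s /AB].
Qed.

Definition grid (R : realType) (n : nat) (v : R) : int := Num.floor (n%:R * v)%R.

Lemma grid_itv (R : realType) n (v : R) h : 0 < n ->
  (grid n v == h) = (v \in `[(h%:~R / n%:R)%R, ((h + 1)%:~R / n%:R)%R[%R).
Proof.
move=> n0; rewrite /grid floor_eq in_itv /= ler_pdivrMr ?ltr0n // ltr_pdivlMr ?ltr0n //.
by rewrite ![(_ * v)%R]mulrC.
Qed.

(** Induction on the dimension: the slice at [x] keeps the lists with head [grid n x], so in the
    outer integral each list contributes the indicator of an interval of length 1/n. *)
Lemma volume_grid (R : realType) D n (L : seq (seq int)) : 0 < n -> uniq L ->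
  (forall l, l \in L -> size l = D) ->
  volume D [set s : seq R | map (grid n) s \in L] = ((size L)%:R / n%:R ^+ D)%:E%R.
Proof.
move=> n0; have nR : (n%:R != 0 :> R)%R by rewrite pnatr_eq0 -lt0n.
elim: D L => [|D IH] L uL sL /=.
  rewrite expr0 divr1; case: asboolP => /= H.
    suff -> : L = [:: [::]] by [].
    apply: perm_small_eq => //; apply: uniq_perm => // l; rewrite inE;
      apply/idP/eqP => [/sL/size0nil //|->//].
  case: L uL sL H => // l L _ sL; have := sL l (mem_head _ _).
  by move=> /size0nil -> []; rewrite mem_head.
pose itv (h : int) : set R := [set` `[(h%:~R / n%:R)%R, ((h + 1)%:~R / n%:R)%R[%R]%classic.
have slice x : volume D [set s : seq R | (grid n x :: map (grid n) s) \in L]%classic =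
    (\sum_(l <- L) (n%:R ^- D)%:E * (\1_(itv (head 0%R l)) x)%:E)%E.
  pose Lx := [seq behead l | l <- L & head 0%R l == grid n x].
  have cons l : l \in L -> l = head 0%R l :: behead l by move=> /sL; case: l.
  rewrite (_ : [set s | _] = [set s | map (grid n) s \in Lx])%classic; last first.
    apply/seteqP; split=> s /= sl.
      by apply/mapP; exists (grid n x :: map (grid n) s) => //; rewrite mem_filter eqxx sl.
    move: sl => /mapP[l]; rewrite mem_filter => /andP[/eqP hl lL] ->.
    by rewrite -hl -cons.
  rewrite IH; last 2 first.
  - rewrite map_inj_in_uniq ?filter_uniq // => l k; rewrite !mem_filter.
    move=> /andP[/eqP hl lL] /andP[/eqP hk kL] E.
    by rewrite (cons _ lL) (cons _ kL) hl hk E.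
  - move=> l /mapP[k]; rewrite mem_filter => /andP[_ /sL].
    by case: k => //= y k [] <- ->.
  rewrite size_map size_filter -sum1_count natr_sum mulr_suml -sumEFin big_mkcond.
  apply: eq_bigr => l _; rewrite -EFinM indicE mem_setE -grid_itv // eq_sym.
  by case: eqP => _; rewrite ?mul1r ?mulr1 ?mulr0.
under eq_integral do rewrite slice.
rewrite ge0_integral_sum //; last first.
  move=> l; apply: measurable_funeM.
  by apply/measurable_EFinP; apply: measurable_indic; exact: measurable_itv.
rewrite (eq_bigr (fun=> (n%:R ^- D.+1)%:E)).
  by rewrite sumEFin big_const_seq count_predT iter_addr addr0 mulr_natl.
move=> l _; rewrite ge0_integralZl_EFin //; last first.
  by apply/measurable_EFinP; apply: measurable_indic; exact: measurable_itv.
rewrite integral_indic //; last exact: measurable_itv.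
rewrite setIT; transitivity ((n%:R ^- D)%:E * (n%:R^-1)%:E : \bar R)%E; last first.
  by rewrite -EFinM exprS invfM mulrC.
congr (_ * _)%E; apply: etrans (lebesgue_measure_itv _) _.
rewrite /= lte_fin ltr_pM2r ?invr_gt0 ?ltr0n // ltr_int ltrDl ltr01 -EFinB.
by rewrite -mulrBl intrD addrAC subrr add0r mul1r.
Qed.

(** * Volume of the transportation polytope *)

Definition flat (T : Type) b a (y : 'M[T]_(b, a)) : seq T :=
  flatten [seq [seq y i j | j <- enum 'I_a] | i <- enum 'I_b].

Definition corner (T : Type) b a (x : 'M[T]_(b.+1, a.+1)) : 'M[T]_(b, a) :=
  mxsub (lift ord_max) (lift ord_max) x.

Lemma transport_coordsE (R : realType) a b (x : 'M[R]_(b.+1, a.+1)) :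
  @transport_coords R a.+1 b.+1 x = flat (corner x).
Proof.
have enumE n : [seq i : 'I_n.+1 <- enum 'I_n.+1 | (i < n.+1.-1)%N] = map (lift ord_max) (enum 'I_n).
  rewrite enum_ordSr filter_rcons /= ltnn filter_map (eq_filter (a2 := predT)) => [|i];
    last by rewrite /= ltn_ord.
  by rewrite filter_predT; apply: eq_map => i; apply: val_inj; rewrite /= /bump leqNgt ltn_ord.
rewrite /transport_coords !enumE -map_comp /flat; congr flatten; apply: eq_map => i /=.
by rewrite -map_comp; apply: eq_map => j /=; rewrite mxE.
Qed.

Lemma map_flat (T U : Type) (f : T -> U) b a (y : 'M[T]_(b, a)) :
  map f (flat y) = flat (map_mx f y).
Proof.
rewrite /flat map_flatten -map_comp; congr flatten; apply: eq_map => i /=.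
by rewrite -map_comp; apply: eq_map => j /=; rewrite mxE.
Qed.

Lemma shape_flat (T : Type) b a (y : 'M[T]_(b, a)) :
  shape [seq [seq y i j | j <- enum 'I_a] | i <- enum 'I_b] = nseq b a.
Proof.
rewrite /shape -map_comp (eq_map (g := fun=> a)) => [|i /=]; last by rewrite size_map size_enum_ord.
by rewrite -[in RHS](size_enum_ord b); elim: (enum _) => //= i s ->.
Qed.

Lemma size_flat (T : Type) b a (y : 'M[T]_(b, a)) : size (flat y) = b * a.
Proof. by rewrite size_flatten shape_flat sumn_nseq mulnC. Qed.

Lemma flat_inj (T : Type) b a : injective (@flat T b a).
Proof.
move=> y z E; have {}E := eq_from_flatten_shape E (etrans (shape_flat y) (esym (shape_flat z))).
apply/matrixP => i j; have /eq_in_map/(_ i) := E; rewrite mem_enum => /(_ isT).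
by move=> /eq_in_map/(_ j); rewrite mem_enum => /(_ isT).
Qed.

Lemma flat_surj (T : Type) (t : T) b a (s : seq T) : size s = b * a ->
  exists y : 'M[T]_(b, a), flat y = s.
Proof.
move=> ss; exists (\matrix_(i, j) nth t (nth [::] (reshape (nseq b a) s) i) j)%R.
have sh : shape (reshape (nseq b a) s) = nseq b a.
  by apply: reshapeKl; rewrite sumn_nseq ss mulnC.
rewrite /flat -[RHS](reshapeKr (sh := nseq b a)); last by rewrite sumn_nseq ss mulnC.
congr flatten; apply: (@eq_from_nth _ [::]).
  by rewrite size_map size_enum_ord size_reshape size_nseq.
move=> i; rewrite size_map size_enum_ord => ib.
rewrite (nth_map (Ordinal ib)) ?size_enum_ord //.
have si : size (nth [::] (reshape (nseq b a) s) i) = a.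
  by rewrite -(nth_shape) sh nth_nseq ib.
apply: (@eq_from_nth _ t); first by rewrite size_map size_enum_ord si.
move=> j; rewrite size_map size_enum_ord => ja.
rewrite (nth_map (Ordinal ja)) ?size_enum_ord // mxE !nth_enum_ord //.
Qed.

Lemma sum_ord_lift (V : nmodType) n (F : 'I_n.+1 -> V) :
  (\sum_i F i = \sum_i F (lift ord_max i) + F ord_max)%R.
Proof.
rewrite big_ord_recr /=; congr (_ + _)%R; apply: eq_bigr => i _; congr F.
by apply: val_inj; rewrite /= /bump leqNgt ltn_ord.
Qed.

Lemma margins_corner_inj b a A B n (x y : 'M[nat]_(b.+1, a.+1)) :
  margins A B n x -> margins A B n y -> corner x = corner y -> x = y.
Proof.
move=> [xA xB] [yA yB] /matrixP E.
have Ef i j : x (lift ord_max i) (lift ord_max j) = y (lift ord_max i) (lift ord_max j).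
  by have := E i j; rewrite !mxE.
have Er i j : x (lift ord_max i) j = y (lift ord_max i) j.
  case: (unliftP ord_max j) => [j' -> //|->].
  have : \sum_j x (lift ord_max i) j = \sum_j y (lift ord_max i) j.
    by apply/eqP; rewrite -eqz_nat xA yA.
  rewrite ![X in X = _ -> _]sum_ord_lift ![X in _ = X -> _]sum_ord_lift.
  by rewrite (eq_bigr _ (fun j _ => Ef i j)) => /addnI.
apply/matrixP => i j; case: (unliftP ord_max i) => [i' -> //|->].
have : \sum_i x i j = \sum_i y i j by apply/eqP; rewrite -eqz_nat xB yB.
rewrite ![X in X = _ -> _]sum_ord_lift ![X in _ = X -> _]sum_ord_lift.
by rewrite (eq_bigr _ (fun i _ => Er i j)) => /addnI.
Qed.

(** Inverse of [corner] for prescribed margins: the rows give the last column, the columns give the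
    last row, and the last row gives its final entry. The last column then has the right sum because
    the totals agree. *)
Definition complete (V : zmodType) b a (r : 'I_b.+1 -> V) (c : 'I_a.+1 -> V) (y : 'M[V]_(b, a)) :
    'M[V]_(b.+1, a.+1) :=
  (\matrix_(i, j) match unlift ord_max i, unlift ord_max j with
    | Some i', Some j' => y i' j'
    | Some i', None => r i - \sum_j y i' j
    | None, Some j' => c j - \sum_i y i j'
    | None, None => r ord_max - \sum_j c (lift ord_max j) + \sum_i \sum_j y i j
    end)%R.

Lemma corner_complete (V : zmodType) b a r c (y : 'M[V]_(b, a)) : corner (complete r c y) = y.
Proof. by apply/matrixP => i j; rewrite !mxE !liftK. Qed.

Lemma complete_rows (V : zmodType) b a r c (y : 'M[V]_(b, a)) i :
  (\sum_j complete r c y i j = r i)%R.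
Proof.
rewrite sum_ord_lift; case: (unliftP ord_max i) => [i' ->|->].
  rewrite [in X in (_ + X)%R]mxE liftK unlift_none.
  by rewrite (eq_bigr (y i')) => [|j _]; rewrite ?subrKC // mxE !liftK.
rewrite [in X in (_ + X)%R]mxE !unlift_none.
rewrite (eq_bigr (fun j => c (lift ord_max j) - \sum_i y i j)%R) => [|j _]; last first.
  by rewrite mxE unlift_none liftK.
rewrite sumrB [in X in (_ - X + _)%R]exchange_big /=.
by rewrite addrC addrACA subrK subrr addr0.
Qed.

Lemma complete_cols (V : zmodType) b a r c (y : 'M[V]_(b, a)) j :
  (\sum_i r i = \sum_j c j)%R -> (\sum_i complete r c y i j = c j)%R.
Proof.
rewrite ![X in (X = _ -> _)%R]sum_ord_lift ![X in (_ = X -> _)%R]sum_ord_lift => rc.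
rewrite sum_ord_lift; case: (unliftP ord_max j) => [j' ->|->].
  rewrite [in X in (_ + X)%R]mxE liftK unlift_none.
  by rewrite (eq_bigr (fun i => y i j')) => [|i _]; rewrite ?subrKC // mxE !liftK.
rewrite [in X in (_ + X)%R]mxE !unlift_none.
rewrite (eq_bigr (fun i => r (lift ord_max i) - \sum_j y i j)%R) => [|i _]; last first.
  by rewrite mxE unlift_none liftK.
rewrite sumrB addrC addrACA subrr addr0 addrAC [(r _ + _)%R]addrC rc.
by rewrite addrAC subrr add0r.
Qed.

Definition last_or n (p q : int) (i : 'I_n.+1) : int := if i == ord_max then p else q.

Lemma last_or_lift n p q (i : 'I_n) : last_or p q (lift ord_max i) = q.
Proof. by rewrite /last_or eq_sym (negbTE (neq_lift _ _)). Qed.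

Lemma last_or_max n p q : last_or p q (@ord_max n) = p.
Proof. by rewrite /last_or eqxx. Qed.

Lemma sum_last_or n p q : (\sum_(i < n.+1) last_or p q i = q *+ n + p)%R.
Proof.
rewrite sum_ord_lift last_or_max; under eq_bigr do rewrite last_or_lift.
by rewrite sumr_const card_ord.
Qed.

Definition transport_volume (R : realType) a b : \bar R :=
  volume (b * a) ((@transport_coords R a.+1 b.+1) @` (@transport_polytope R a.+1 b.+1))%classic.

Lemma grid_le (R : realType) n (v : R) : ((grid n v)%:~R <= n%:R * v)%R.
Proof. by have /andP[] := floor_itv (n%:R * v)%R. Qed.

Lemma grid_gt (R : realType) n (v : R) : (n%:R * v < (grid n v)%:~R + 1)%R.
Proof. by have /andP[_] := floor_itv (n%:R * v)%R; rewrite intrD. Qed.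

Lemma margins_corner_list b a (A : 'I_b.+1 -> int) (B : 'I_a.+1 -> int) n u :
  hascard (margins A B n) u ->
  exists L : seq (seq int), [/\ uniq L, size L = u, (forall l, l \in L -> size l = b * a)
    & forall l, l \in L <-> exists2 z, margins A B n z & l = flat (map_mx Posz (corner z))].
Proof.
move=> [l [ul lP su]]; exists [seq flat (map_mx Posz (corner z)) | z <- l]; split.
- rewrite map_inj_in_uniq // => x y /lP mx /lP my /flat_inj /matrixP E.
  apply: (margins_corner_inj mx my); apply/matrixP => i j.
  by have := E i j; rewrite [LHS]mxE [RHS]mxE => -[].
- by rewrite size_map.
- by move=> _ /mapP[z _ ->]; rewrite size_flat.
- move=> s; split=> [/mapP[z /lP mz ->]|[z mz ->]]; first by exists z.
  by apply/mapP; exists z => //; apply/lP.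
Qed.

Lemma natr_sum1 (R : realType) k : (k%:R = \sum_(i < k) 1 :> R)%R.
Proof. by rewrite sumr_const card_ord. Qed.

(* The offset [b * a] of the last margins compensates for rounding down the [b * a]
   free entries, which can make the bottom right entry negative. *)
Lemma volume_upper (R : realType) a b n u (D := Posz (b * a)) : 0 < n ->
  hascard (@margins b.+1 a.+1 (last_or D 0%R) (last_or D 0%R) n) u ->
  (transport_volume R a b <= (u%:R / n%:R ^+ (b * a))%:E)%E.
Proof.
move=> n0; have nR : (0 < n%:R :> R)%R by rewrite ltr0n.
move=> /margins_corner_list[L [uL <- sL LP]].
rewrite -(volume_grid R n0 uL sL); apply: volume_mono => _ [x [x0 xr xc] <-].
rewrite transport_coordsE /= map_flat; apply/LP.
set y := map_mx _ _.
have yle i j : ((y i j)%:~R <= n%:R * x (lift ord_max i) (lift ord_max j))%R.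
  by rewrite !mxE grid_le.
have ygt i j : (n%:R * x (lift ord_max i) (lift ord_max j) < (y i j)%:~R + 1)%R.
  by rewrite !mxE grid_gt.
pose r (i : 'I_b.+1) := (last_or D 0 i + (n * a.+1)%N%:Z)%R.
pose c (j : 'I_a.+1) := (last_or D 0 j + (n * b.+1)%N%:Z)%R.
have rc : (\sum_i r i = \sum_j c j)%R.
  rewrite !big_split /= !sum_last_or !mul0rn !sumr_const !card_ord -(mulr_natr _ b.+1)
    -(mulr_natr _ a.+1) !natz.
  by rewrite -!PoszM -!mulnA [b.+1 * a.+1]mulnC.
(* Completing the floors yields the margins by construction; what remains is the sign of each of the
   four kinds of entries. *)
pose w := complete r c y.
have w0 i j : (0 <= w i j)%R.
  rewrite /w mxE; case: (unliftP ord_max i) => [i' iE|iE]; case: (unliftP ord_max j) => [j' jE|jE].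
  - by rewrite !mxE /grid floor_ge0 mulr_ge0 // ltW.
  - rewrite ?iE ?jE subr_ge0 -(ler_int R) raddf_sum /=.
    apply: le_trans (ler_sum _ (fun j _ => yle i' j)) _.
    rewrite -mulr_sumr /r last_or_lift add0r -pmulrn natrM ler_pM2l //.
    by rewrite -(xr (lift ord_max i')) sum_ord_lift lerDl.
  - rewrite ?iE ?jE subr_ge0 -(ler_int R) raddf_sum /=.
    apply: le_trans (ler_sum _ (fun i _ => yle i j')) _.
    rewrite -mulr_sumr /c last_or_lift add0r -pmulrn natrM ler_pM2l //.
    by rewrite -(xc (lift ord_max j')) sum_ord_lift lerDl.
  - rewrite -(ler_int R) intrD intrB !raddf_sum /= /r last_or_max.
    have : (n%:R * \sum_i \sum_j x (lift ord_max i) (lift ord_max j) <=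
        \sum_i (\sum_j y i j)%R%:~R + (b * a)%:R)%R.
      rewrite (_ : (b * a)%:R = \sum_(i < b) \sum_(j < a) 1)%R; last first.
        by rewrite !sumr_const !card_ord -mulrnA mulnC.
      rewrite -big_split mulr_sumr; apply: ler_sum => i' _ /=.
      rewrite raddf_sum -big_split mulr_sumr.
      by apply: ler_sum => j' _; apply: ltW.
    have -> : (\sum_i \sum_j x (lift ord_max i) (lift ord_max j) =
        a%:R * b.+1%:R - (a.+1%:R - x ord_max ord_max))%R.
      rewrite -(xr ord_max) [X in (_ - (X - _))%R]sum_ord_lift addrK exchange_big mulr_natl.
      rewrite (_ : b.+1%:R *+ a = \sum_(j < a) b.+1%:R)%R; last by rewrite sumr_const card_ord.
      rewrite -sumrB; apply: eq_bigr => j' _.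
      by rewrite -(xc (lift ord_max j')) [X in (_ = X - _)%R]sum_ord_lift addrK.
    rewrite (eq_bigr (fun=> (- (n%:R * b.+1%:R) : R)%R)) => [|k _]; last first.
      by rewrite /c last_or_lift add0r -pmulrn natrM.
    rewrite sumr_const card_ord -mulr_natl intrD -!pmulrn natrM.
    have := mulr_ge0 (ltW nR) (x0 ord_max ord_max); lra.
have wy : corner w = y by exact: corner_complete.
have wr i : (\sum_j w i j = r i)%R by exact: complete_rows.
have wc j : (\sum_i w i j = c j)%R by exact: complete_cols.
move: w w0 wy wr wc => {rc} w w0 <- wr wc.
exists (map_mx absz w); last first.
  by congr flat; apply/matrixP => i j; rewrite !mxE gez0_abs.
split=> [i|j]; rewrite sum_Posz.
  by rewrite -[RHS]/(r i) -wr; apply: eq_bigr => j _; rewrite mxE gez0_abs.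
by rewrite -[RHS]/(c j) -wc; apply: eq_bigr => i _; rewrite mxE gez0_abs.
Qed.

(* The offsets are those for which every point of the cube at a matrix with these
   margins is in the scaled polytope. *)
Lemma volume_lower (R : realType) a b n u (D := Posz (b * a)) : 0 < n ->
  hascard (@margins b.+1 a.+1 (last_or (- D)%R (- Posz a)%R) (last_or (- D)%R (- Posz b)%R) n) u ->
  ((u%:R / n%:R ^+ (b * a))%:E <= transport_volume R a b)%E.
Proof.
move=> n0; have nR : (0 < n%:R :> R)%R by rewrite ltr0n.
move=> /margins_corner_list[L [uL <- sL LP]].
rewrite -(volume_grid R n0 uL sL); apply: volume_mono => s /= /LP[z [zr zc] sz].
have [|y ys] := flat_surj (0 : R)%R (s := s) (b := b) (a := a).
  by have := congr1 size sz; rewrite size_map size_flat.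
have zy i j : Posz (z (lift ord_max i) (lift ord_max j)) = grid n (y i j).
  by move: sz; rewrite -ys map_flat => /flat_inj/matrixP/(_ i j); rewrite !mxE.
have yge i j : ((z (lift ord_max i) (lift ord_max j))%:R <= n%:R * y i j)%R.
  by have := grid_le n (y i j); rewrite -zy -pmulrn.
have ylt i j : (n%:R * y i j < (z (lift ord_max i) (lift ord_max j))%:R + 1)%R.
  by have := grid_gt n (y i j); rewrite -zy -pmulrn.
pose x := complete (fun=> a.+1%:R : R)%R (fun=> b.+1%:R : R)%R y.
exists x; last by rewrite transport_coordsE corner_complete.
split=> [i j|i|j]; last 2 first.
- exact: complete_rows.
- by apply: complete_cols; rewrite !sumr_const !card_ord -!mulrnA mulnC.
rewrite -(pmulr_rge0 _ nR).
rewrite /x mxE; case: (unliftP ord_max i) => [i' iE|iE]; case: (unliftP ord_max j) => [j' jE|jE].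
- exact: le_trans (yge _ _).
(* After scaling, each of the [a] free entries of the row exceeds its floor by less than one, which
   the offset [- a] absorbs. *)
- have : (n%:R * \sum_j y i' j <= (\sum_j z (lift ord_max i') (lift ord_max j))%:R + a%:R)%R.
    rewrite [X in (_ <= _ + X)%R](natr_sum1 R a) natr_sum -big_split mulr_sumr.
    by apply: ler_sum => j' _; apply: ltW.
  have := zr (lift ord_max i'); rewrite last_or_lift sum_ord_lift.
  move: (\sum_(i < a) _) (z _ _) => S t E.
  have {E} : S <= n * a.+1 - a by lia.
  rewrite -(ler_nat R) natrB ?natrM => [H1 H2|]; last exact: leq_trans (leqnSn a) (leq_pmull _ n0).
  by rewrite mulrBr subr_ge0; lra.
- have : (n%:R * \sum_i y i j' <= (\sum_i z (lift ord_max i) (lift ord_max j'))%:R + b%:R)%R.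
    rewrite [X in (_ <= _ + X)%R](natr_sum1 R b) natr_sum -big_split mulr_sumr.
    by apply: ler_sum => i' _; apply: ltW.
  have := zc (lift ord_max j'); rewrite last_or_lift sum_ord_lift.
  move: (\sum_(i < b) _) (z _ _) => S t E.
  have {E} : S <= n * b.+1 - b by lia.
  rewrite -(ler_nat R) natrB ?natrM => [H1 H2|]; last exact: leq_trans (leqnSn b) (leq_pmull _ n0).
  by rewrite mulrBr subr_ge0; lra.
(* The bottom right entry increases with the free entries, so here the floors err on the safe side;
   the offset [- D] of the last row cancels the [a] column offsets [- b]. *)
have E1 : ((\sum_i \sum_j z (lift ord_max i) (lift ord_max j))%:R <= n%:R * \sum_i \sum_j y i j)%R.
  rewrite natr_sum mulr_sumr; apply: ler_sum => i' _.
  by rewrite natr_sum mulr_sumr; apply: ler_sum => j' _.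
have E2 : \sum_i \sum_j z (lift ord_max i) (lift ord_max j) + \sum_j z ord_max (lift ord_max j) +
  a * b = a * (n * b.+1).
  have sumc k : a * k = \sum_(j < a) k by rewrite sum_nat_const card_ord.
  rewrite !sumc exchange_big -!big_split; apply: eq_bigr => j' _; have := zc (lift ord_max j');
    rewrite last_or_lift sum_ord_lift.
  by move: (\sum_(i < b) _) (z _ _) => S t /=; lia.
have E3 : \sum_j z ord_max (lift ord_max j) + z ord_max ord_max + b * a = n * a.+1.
  by have := zr ord_max; rewrite last_or_max sum_ord_lift /D;
    move: (\sum_(i < a) _) (z _ _) => S t /=; lia.
rewrite sumr_const card_ord -[(b.+1%:R *+ a)%R]mulr_natl.
have {E2 E3} : a * (n * b.+1) <= \sum_i \sum_j z (lift ord_max i) (lift ord_max j) + n * a.+1.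
  by rewrite -E2 -E3 [b * a]mulnC; lia.
rewrite -(ler_nat R) natrD !natrM => E2.
rewrite mulrDr mulrBr; lra.
Qed.

(** * Degree and leading coefficient *)

Lemma lead_coef_ge0 (R : realType) (p : {poly R}) N :
  (forall n, N <= n -> (0 <= p.[n%:R])%R) -> (0 <= lead_coef p)%R.
Proof.
move=> pN; rewrite leNgt -oppr_gt0 -lead_coefN; apply/negP => /[dup] l0 /poly_pinfty_gt_lc[x xP].
pose n := maxn N (Num.bound x).
have := pN n (leq_maxl _ _); have := xP n%:R%R; rewrite hornerN => H.
have {}H := lt_le_trans l0 (H _).
have xn : (x <= n%:R)%R.
  rewrite (le_trans (ler_norm x)) // (le_trans (ltW (archi_boundP (normr_ge0 x)))) // ler_nat.
  by rewrite leq_max; apply/orP; right; rewrite /Num.bound normr_id.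
by have := H xn; lra.
Qed.

(** The differences of [p] with the two bounds have nonnegative leading coefficients, while their
    sum has degree below [D]. Nonnegative top coefficients cannot cancel, so each difference has
    degree below [D]. *)
Lemma lead_coef_squeeze (R : realType) (p : {poly R}) (v c : R) D N : (0 < v)%R ->
  (forall n, N <= n -> (v * (n%:R - c) ^+ D <= p.[n%:R] <= v * (n%:R + c) ^+ D)%R) ->
  size p = D.+1 /\ lead_coef p = v.
Proof.
move=> v0 pv; have vn0 : v != 0%R by rewrite gt_eqF.
pose b (u : R) : {poly R} := (v *: ('X - u%:P) ^+ D)%R.
have sb u : size (b u) = D.+1 by rewrite size_scale // size_exp_XsubC.
have lb u : lead_coef (b u) = v.
  by rewrite lead_coefZ lead_coef_exp lead_coefXsubC expr1n mulr1.
have hb u x : ((b u).[x] = v * (x - u) ^+ D)%R.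
  by rewrite /b !hornerE.
have q1 : (0 <= lead_coef (p - b c))%R.
  apply: (@lead_coef_ge0 _ _ N) => n /pv/andP[+ _].
  by rewrite hornerD hornerN hb subr_ge0.
have q2 : (0 <= lead_coef (b (- c) - p))%R.
  apply: (@lead_coef_ge0 _ _ N) => n /pv/andP[_].
  by rewrite hornerD hornerN hb opprK subr_ge0.
have s12 : size ((p - b c) + (b (- c) - p))%R <= D.
  apply/leq_sizeP => j; rewrite addrC addrA subrK coefB leq_eqVlt => /orP[/eqP <-|Dj].
    have -> : D = (size (b c)).-1 by rewrite sb.
    by rewrite -[X in (_ - X)%R]lead_coefE lb sb -(sb (- c)%R) -lead_coefE lb subrr.
  by rewrite !nth_default ?subrr ?sb.
have sq : size (p - b c)%R <= D.
  rewrite leqNgt; apply/negP => sD.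
  pose k := (maxn (size (p - b c)%R) (size (b (- c) - p)%R)).-1.
  have kD : D <= k by rewrite /k; lia.
  have coef_ge0 (q : {poly R}) : (0 <= lead_coef q)%R -> size q <= k.+1 ->
      (0 <= q`_k)%R /\ ((q`_k = 0)%R -> size q <= k).
    rewrite leq_eqVlt => lq /orP[/eqP sk|sk].
      have qk : (q`_k = lead_coef q)%R by rewrite lead_coefE sk.
      by split; rewrite qk // => /eqP; rewrite lead_coef_eq0 -size_poly_eq0 sk.
    by rewrite nth_default.
  have [g1 z1] := coef_ge0 _ q1 (ltac:(rewrite /k; lia)).
  have [g2 z2] := coef_ge0 _ q2 (ltac:(rewrite /k; lia)).
  have /eqP := nth_default 0%R (leq_trans s12 kD).
  rewrite coefD paddr_eq0 // => /andP[/eqP /z1 s1 /eqP /z2 s2].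
  by move: s1 s2; rewrite /k; lia.
have pE : p = (b c + (p - b c))%R by rewrite addrC subrK.
split; first by rewrite pE size_polyDl ?sb.
by rewrite pE lead_coefDl ?sb.
Qed.

Theorem margins_quasipoly (R : realType) a b (A : 'I_b.+1 -> int) (B : 'I_a.+1 -> int) f :
  (\sum_i A i = \sum_j B j)%R -> (forall n, hascard (margins A B n) (f n)) ->
  exists (p : {poly rat}) N, [/\ forall n, N <= n -> ((f n)%:R = p.[n%:R])%R,
    size p = (b * a).+1 & ratr (lead_coef p) = fine (transport_volume R a b)].
Proof.
move=> AB fP; set D := b * a.
pose Ar (p q : int) := @last_or b p q; pose Bc (p q : int) := @last_or a p q.
have /choice[fu fuP] n := @margins_hascard b.+1 a.+1 (Ar (Posz D) 0%R) (Bc (Posz D) 0%R) n.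
have /choice[fl flP] n := @margins_hascard b.+1 a.+1
  (Ar (- D%:Z)%R (- a%:Z)%R) (Bc (- D%:Z)%R (- b%:Z)%R) n.
have Eu : (\sum_i Ar D%:Z 0%R i = \sum_j Bc D%:Z 0%R j)%R by rewrite !sum_last_or !mul0rn.
have El : (\sum_i Ar (- D%:Z)%R (- a%:Z)%R i = \sum_j Bc (- D%:Z)%R (- b%:Z)%R j)%R.
  by rewrite !sum_last_or -(mulr_natr _ b) -(mulr_natr _ a) !natz; lia.
have [c1 c1P] := margins_dominated (ltn0Sn a) (ltn0Sn b) AB El.
have [c2 c2P] := margins_dominated (ltn0Sn a) (ltn0Sn b) Eu AB.
pose V := transport_volume R a b.
have Vl n : 0 < n -> (((fl n)%:R / n%:R ^+ D)%:E <= V)%E by move=> n0; exact: volume_lower.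
have Vu n : 0 < n -> (V <= ((fu n)%:R / n%:R ^+ D)%:E)%E by move=> n0; exact: volume_upper.
(* The upper count at [n = 1] is finite, so [fine] loses nothing. *)
have Vfin : V \is a fin_num.
  rewrite ge0_fin_numE; last exact: volume_ge0.
  exact: le_lt_trans (Vu 1 isT) (ltry _).
pose v := fine V; have vE : V = v%:E by rewrite fineK.
have {}Vl n : 0 < n -> ((fl n)%:R <= v * n%:R ^+ D)%R.
  by move=> n0; have := Vl n n0; rewrite vE lee_fin ler_pdivrMr // exprn_gt0 // ltr0n.
have {}Vu n : 0 < n -> (v * n%:R ^+ D <= (fu n)%:R)%R.
  by move=> n0; have := Vu n n0; rewrite vE lee_fin ler_pdivlMr // exprn_gt0 // ltr0n.
(* The lower margins are realised for some positive [n], and the lower count there is a positive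
   bound for the volume. *)
have v0 : (0 < v)%R.
  have [n0 /(_ n0.+1 (leqnSn _))[x mx]] := margins_inhabited (ltn0Sn a) (ltn0Sn b) El.
  have fl0 : 0 < fl n0.+1.
    have [l [_ lP <-]] := flP n0.+1.
    by have : x \in l by [apply/lP]; case: (l).
  rewrite -(pmulr_lgt0 _ (exprn_gt0 D (ltr0Sn R n0))).
  by apply: lt_le_trans (Vl _ (ltn0Sn n0)); rewrite ltr0n.
have [p [N pN]] := margins_evpoly fP.
exists p, N.
have [] := @lead_coef_squeeze R (map_poly ratr p) v (maxn c1 c2)%:R%R D (maxn N (maxn c1 c2).+1) v0.
  move=> n; rewrite geq_max => /andP[Nn cn].
  have -> : ((map_poly ratr p).[n%:R] = (f n)%:R :> R)%R.
    by rewrite -[X in (_.[X])%R](ratr_nat R) horner_map /= -pN // ratr_nat.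
  have n0 : 0 < n by lia.
  apply/andP; split.
    have n2 : 0 < n - c2 by lia.
    have c2f : fu (n - c2) <= f n.
      have -> : n = n - c2 + c2 by lia.
      by rewrite [X in fu X]addnK; exact: c2P.
    rewrite -(ler_nat R) in c2f; apply: le_trans c2f; apply: le_trans (Vu _ n2).
    rewrite ler_pM2l // lerXn2r ?nnegrE // -natrB ?ler_nat //; lia.
  have n1 : 0 < n + c1 by lia.
  have := c1P _ _ _ (fP n) (flP (n + c1)); rewrite -(ler_nat R) => H.
  apply: le_trans H _; apply: le_trans (Vl _ n1) _.
  by rewrite ler_pM2l // lerXn2r ?nnegrE ?addr_ge0 // -natrD ler_nat; lia.
rewrite size_map_poly lead_coef_map => sp lp; split=> //.
Qed.

(** * Partitions as bead sets *)

Lemma nth_sorted_geq l i j : sorted geq l -> i <= j -> nth 0 l j <= nth 0 l i.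
Proof.
move=> sl ij; have [jl|lj] := ltnP j (size l); last by rewrite nth_default.
apply: (sorted_leq_nth (leT := geq)) => //; rewrite ?inE ?(leq_ltn_trans ij) //.
- by move=> x y z /= yx zy; apply: leq_trans zy yx.
- by move=> x; exact: leqnn.
Qed.

(** [count (ltn y) l] is the length of column [y] of the diagram: both sides say that the cell (i,
    y) belongs to it. *)
Lemma count_gt_sorted l y i : sorted geq l -> (y < nth 0 l i) = (i < count (ltn y) l).
Proof.
elim: l i => [|x l IH] i sl; first by rewrite nth_nil.
have xl z : z \in l -> z <= x.
  move=> /(nthP 0)[j jl <-]; exact: (nth_sorted_geq (i := 0) (j := j.+1)) sl _.
case: i => [|i] /=; last first.
  rewrite IH; last exact: path_sorted sl.
  case: (ltnP y x) => // xy; rewrite add0n (_ : count _ _ = 0) //.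
  by apply/eqP; rewrite -leqn0 leqNgt -has_count; apply/hasPn => z /xl zx;
    rewrite -leqNgt (leq_trans zx).
case: (ltnP y x) => // xy; rewrite add0n; apply/esym/negbTE; rewrite -has_count;
  apply/hasPn => z /xl zx.
by rewrite -leqNgt (leq_trans zx).
Qed.

Lemma is_partition_sorted la : is_partition la -> sorted geq la.
Proof. by case/andP. Qed.

Lemma partition_ext la mu : is_partition la -> is_partition mu ->
  (forall i, nth 0 la i = nth 0 mu i) -> la = mu.
Proof.
have pos nu i : is_partition nu -> (i < size nu) = (0 < nth 0 nu i).
  move=> /andP[_ /all_nthP ap]; case: ltnP => ia; last by rewrite nth_default.
  by rewrite ap.
move=> pl pm E; apply: (@eq_from_nth _ 0) => //.
have H i : (i < size la) = (i < size mu) by rewrite !pos // E.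
have := H (size la); have := H (size mu); rewrite !ltnn; lia.
Qed.

(** The zeros of a decreasing list come last, where [nth 0] returns 0 in any case. *)
Lemma filter_pos_sorted l : sorted geq l ->
  is_partition [seq x <- l | 0 < x] /\ forall i, nth 0 [seq x <- l | 0 < x] i = nth 0 l i.
Proof.
move=> sl; split.
  rewrite /is_partition filter_all andbT; apply: sorted_filter sl.
  by move=> x y z /= yx zy; apply: leq_trans zy yx.
elim: l sl => [|[|x] l IH] sl i //=; last by case: i => //= i; apply: IH; exact: path_sorted sl.
have l0 z : z \in l -> z = 0.
  move=> /(nthP 0)[j jl <-]; apply/eqP; rewrite -leqn0.
  exact: (nth_sorted_geq (i := 0) (j := j.+1)) sl _.
rewrite (_ : [seq x <- l | 0 < x] = [::]); last first.
  by apply/eqP; rewrite -[_ == _]negbK -has_filter; apply/hasPn => z /l0 ->.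
rewrite nth_nil; case: i => //= i; have [il|il] := ltnP i (size l); last by rewrite nth_default.
by rewrite (l0 (nth 0 l i)) ?mem_nth.
Qed.

(* Since [nth 0] is 0 beyond the last part, partitions with fewer than k parts are
   padded with zeros; those with more than k parts are truncated. *)
Definition bead k la i := nth 0 la i + (k - i.+1).

Definition betas k la := mkseq (bead k la) k.

Lemma betasP k la x : reflect (exists2 i, i < k & x = bead k la i) (x \in betas k la).
Proof.
apply: (iffP (nthP 0)) => -[i]; rewrite ?size_mkseq => ik.
  by rewrite nth_mkseq // => <-; exists i.
by move=> ->; exists i; rewrite ?size_mkseq // nth_mkseq.
Qed.

Lemma bead_lt k la i j : is_partition la -> i < j -> j < k -> bead k la j < bead k la i.
Proof.
move=> /is_partition_sorted sl ij jk; have := nth_sorted_geq sl (ltnW ij); rewrite /bead; lia.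
Qed.

Lemma sorted_mkseq (e : rel nat) f k :
  (forall i, i.+1 < k -> e (f i) (f i.+1)) -> sorted e (mkseq f k).
Proof.
move=> ef; apply/(sortedP 0) => i; rewrite size_mkseq => ik.
by rewrite !nth_mkseq ?ef // ltnW.
Qed.

Lemma betas_sorted k la : is_partition la -> sorted gtn (betas k la).
Proof. by move=> pl; apply: sorted_mkseq => i ik; apply: bead_lt. Qed.

Lemma gtn_trans : transitive gtn.
Proof. by move=> x y z /= yx xz; apply: ltn_trans xz yx. Qed.

Lemma gtn_irr : irreflexive gtn.
Proof. by move=> x; exact: ltnn. Qed.

Lemma betas_uniq k la : is_partition la -> uniq (betas k la).
Proof. move=> pl; exact: (sorted_uniq gtn_trans gtn_irr) (betas_sorted k pl). Qed.

Lemma gtn_geq_sorted l : sorted gtn l -> sorted geq l.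
Proof. by apply: sub_sorted => x y /ltnW. Qed.

Lemma betas_inj k la mu : is_partition la -> is_partition mu -> size la <= k -> size mu <= k ->
  betas k la =i betas k mu -> la = mu.
Proof.
move=> pl pm sl sm E; apply: partition_ext => // i.
have {}E : betas k la = betas k mu.
  by apply: (irr_sorted_eq gtn_trans gtn_irr) => //; exact: betas_sorted.
have [ik|ki] := ltnP i k; last by rewrite !nth_default ?(leq_trans _ ki).
have := congr1 (nth 0 ^~ i) E; rewrite !nth_mkseq // /bead; lia.
Qed.

Lemma betas_surj k B : sorted gtn B -> size B = k ->
  exists la, [/\ is_partition la, size la <= k & betas k la = B].
Proof.
move=> sB sk; pose l := mkseq (fun i => nth 0 B i - (k - i.+1)) k.
(* In a strictly decreasing list the term at [i] has [k - i.+1] smaller naturals after it, so the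
   subtraction in [l] is never truncated. *)
have lb i : i < k -> k - i.+1 <= nth 0 B i.
  move=> ik; have [m mk] : exists m, m = k - i.+1 by exists (k - i.+1).
  rewrite -mk; elim: m i ik mk => // m IH i ik mk.
  have ik' : i.+1 < k by lia.
  apply: leq_ltn_trans (IH i.+1 ik' _) _; first by lia.
  have := sorted_ltn_nth gtn_trans 0 sB i i.+1.
  by rewrite !inE sk ik ik' => /(_ isT isT (ltnSn i)) /=.
have sl : sorted geq l.
  apply: sorted_mkseq => i ik; have := lb i.+1 ik.
  have := sorted_ltn_nth gtn_trans 0 sB i i.+1.
  by rewrite !inE sk ik (ltnW ik) => /(_ isT isT (ltnSn i)) /=; lia.
have [pl nl] := filter_pos_sorted sl.
exists [seq x <- l | 0 < x]; split=> //.
  by rewrite size_filter (leq_trans (count_size _ _)) // size_mkseq.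
apply: (@eq_from_nth _ 0); rewrite size_mkseq // => i ik.
by rewrite nth_mkseq // /bead nl nth_mkseq // subnK // lb.
Qed.

(** * Cores and rim hooks *)

(** Arm plus leg plus one, with the leg read off the length of column [j]; terms are moved across to
    avoid truncated subtraction. *)
Lemma hook_length_count la i j : is_partition la -> j < nth 0 la i ->
  hook_length la i j + (j + i.+1) = nth 0 la i + count (ltn j) la.
Proof.
move=> pl ji; have sl := is_partition_sorted pl.
have ic : i < count (ltn j) la by rewrite -count_gt_sorted.
have il : i < size la by exact: leq_trans ic (count_size _ _).
have cE : count (ltn j) la = i.+1 + count (ltn j) (drop i.+1 la).
  rewrite -{1}(cat_take_drop i.+1 la) count_cat; congr addn.
  rewrite -[RHS](size_takel il); apply/eqP; rewrite -all_count; apply/(all_nthP 0) => i'.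
  rewrite size_takel // ltnS => i'i; rewrite nth_take ?ltnS //=.
  by apply: leq_trans ji _; apply: nth_sorted_geq.
rewrite cE /hook_length -[count (fun x => _) _]/(count (ltn j) (drop i.+1 la)).
by move: (count _ _) => n; lia.
Qed.

(** Along the boundary of the diagram, read from the bottom of its [k] rows, the beads are the
    positions of the vertical steps; this is the position of the horizontal step of column [j]. *)
Lemma gap_notin_betas k la j : is_partition la -> size la <= k ->
  j + (k - count (ltn j) la) \notin betas k la.
Proof.
move=> pl lk; have sl := is_partition_sorted pl; apply/negP => /betasP[i ik].
have := count_gt_sorted j i sl;
  have : count (ltn j) la <= k by apply: leq_trans (count_size _ _) lk.
rewrite /bead; case: (ltnP j (nth 0 la i)); case: (ltnP i (count (ltn j) la)) => //; lia.
Qed.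

(** Conversely, a gap [y] with [r] beads above it is the horizontal step of column [y - (k - r)],
    and that column meets exactly the first [r] of the [k] rows. The [k - r] beads below [y] are
    distinct, whence the first inequality. *)
Lemma nonbead_col k la y : is_partition la -> y \notin betas k la ->
  let r := count (ltn y) (betas k la) in
  [/\ k <= y + r, forall i, i < k -> (y < bead k la i) = (i < r)
    & forall i, i < k -> (y - (k - r) < nth 0 la i) = (i < r)].
Proof.
move=> pl yB r; have sB := gtn_geq_sorted (betas_sorted k pl).
have rk : r <= k by rewrite -[k in _ <= k](size_mkseq (bead k la)) count_size.
have br i : i < k -> (y < bead k la i) = (i < r).
  by move=> ik; rewrite -count_gt_sorted // nth_mkseq.
have by' i : i < k -> y != bead k la i by move=> ik; apply: contra yB => /eqP ->; apply/betasP;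
  exists i.
have kr : k <= y + r.
  have [rk'|] := ltnP r k; last by lia.
  by have := br r rk'; rewrite ltnn; have := by' r rk'; rewrite /bead; lia.
split=> // i ik; apply/idP/idP => [|ir].
  apply: contraTT; rewrite -!leqNgt => ri.
  have rk' : r < k by exact: leq_ltn_trans ik.
  apply: leq_trans (nth_sorted_geq (is_partition_sorted pl) ri) _.
  by have := br r rk'; have := by' r rk'; rewrite /bead ltnn; lia.
have r1k : r.-1 < k by lia.
have : y < bead k la r.-1 by rewrite br //; lia.
rewrite /bead => H; have := nth_sorted_geq (is_partition_sorted pl) (_ : i <= r.-1); lia.
Qed.

(** The hook length at row [i] and column [j] is the bead of row [i] minus the gap of column [j], so
    a hook of length [t] is a bead [x] with a gap at [x - t]. *)
Lemma is_core_betas t k la : 0 < t -> is_partition la -> size la <= k ->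
  is_core t la <-> forall x, x \in betas k la -> t <= x -> x - t \in betas k la.
Proof.
move=> t0 pl lk; have sl := is_partition_sorted pl; split=> [[_ hk] x /betasP[i ik ->] tx|fl].
  apply: contraT => yB; set y := bead k la i - t in yB.
  have [kr br nr] := nonbead_col pl yB.
  set r := count _ _ in kr br nr; set j := y - (k - r).
  have ir : i < r by rewrite -br // /y; lia.
  have ji : j < nth 0 la i by rewrite nr.
  have rk : r <= k by rewrite -[k in _ <= k](size_mkseq (bead k la)) count_size.
  have cr : count (ltn j) la = r.
    apply/eqP; rewrite eqn_leq; apply/andP; split.
      have [|kr'] := ltnP r k; last exact: leq_trans (count_size _ _) (leq_trans lk kr').
      by move=> rk'; rewrite leqNgt -count_gt_sorted // nr // ltnn.
    have -> : r = r.-1.+1 by lia.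
    by rewrite -count_gt_sorted // nr //; lia.
  have il : i < size la by rewrite ltnNge; apply/negP => li; rewrite nth_default in ji.
  exfalso; apply: (hk i j); first by rewrite /in_diagram /= il.
  have := hook_length_count pl ji; rewrite cr /j /y /bead in kr tx *; lia.
split=> // i j /andP[/= il ji] ht; have ik : i < k by exact: leq_trans il lk.
have hc := hook_length_count pl ji; rewrite ht in hc.
have cs : count (ltn j) la <= size la by exact: count_size.
have xB : bead k la i \in betas k la by apply/betasP; exists i.
have := fl _ xB; have := gap_notin_betas j pl lk.
have -> : j + (k - count (ltn j) la) = bead k la i - t by rewrite /bead; lia.
by move=> /negbTE -> H; have : false by apply: H; rewrite /bead; lia.
Qed.

(** Removing a rim hook in rows [p] to [q] hands each of these rows the bead of the next one and
    gives row [q] the new bead [y]; as sets, one bead has moved. *)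
Lemma betas_shift k la mu p q y : p <= q -> q < k ->
  (forall i, i < k -> (i < p) || (q < i) -> bead k mu i = bead k la i) ->
  (forall i, p <= i < q -> bead k mu i = bead k la i.+1) ->
  bead k mu q = y ->
  perm_eq (bead k la p :: betas k mu) (y :: betas k la).
Proof.
move=> pq qk out inn lst.
have kE : k = p + ((q - p).+1 + (k - q.+1)) by lia.
have -> : betas k mu = map (bead k la) (iota 0 p) ++
    (rcons (map (bead k la) (iota p.+1 (q - p))) y ++ map (bead k la) (iota q.+1 (k - q.+1))).
  rewrite /betas /mkseq {2}kE iotaD map_cat; congr (_ ++ _).
    by apply/eq_in_map => i; rewrite mem_iota add0n => ip; apply: out => //; lia.
  rewrite iotaD map_cat add0n; congr (_ ++ _); last first.
    have -> : p + (q - p).+1 = q.+1 by lia.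
    by apply/eq_in_map => i; rewrite mem_iota => iq; apply: out => //; lia.
  rewrite -addn1 iotaD map_cat /= subnKC // lst cats1; congr rcons.
  rewrite -[p.+1]add1n iotaDl -map_comp; apply/eq_in_map => i; rewrite mem_iota => ip.
  by rewrite /= add1n; apply: inn; lia.
have -> : betas k la = map (bead k la) (iota 0 p) ++
    (bead k la p :: map (bead k la) (iota p.+1 (q - p)) ++ map (bead k la) (iota q.+1 (k - q.+1))).
  rewrite /betas /mkseq {2}kE iotaD map_cat iotaD map_cat add0n /=.
  by have -> : p + (q - p).+1 = q.+1 by lia.
apply/permP => P; rewrite /= !count_cat -cats1 !count_cat /= !count_cat /=; lia.
Qed.

Lemma sumn_nth la k : size la <= k -> sumn la = \sum_(i < k) nth 0 la i.
Proof.
move=> lk; rewrite sumnE (big_nth 0) big_mkord (big_ord_widen k (nth 0 la)) //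
  [RHS](bigID (fun i : 'I_k => i < size la)) /=.
by rewrite [X in _ + X]big1 ?addn0 // => i; rewrite -leqNgt => li; rewrite nth_default.
Qed.

Lemma sumn_betas k la : size la <= k -> sumn (betas k la) = sumn la + \sum_(i < k) (k - i.+1).
Proof.
by move=> lk; rewrite sumnE big_map -[k in iota 0 k]subn0 -/(index_iota 0 k) big_mkord big_split
  /= -sumn_nth.
Qed.

Lemma in_diagramE la i j : in_diagram la (i, j) = (j < nth 0 la i).
Proof.
rewrite /in_diagram /=; case: ltnP => //= li; by rewrite nth_default.
Qed.

Lemma sub_partition_size la mu : is_partition mu ->
  (forall i, nth 0 mu i <= nth 0 la i) -> size mu <= size la.
Proof.
move=> /andP[_ /(all_nthP 0) pm] ml; rewrite leqNgt; apply/negP => lm.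
by have := pm _ lm; rewrite ltnNge (leq_trans (ml _)) // nth_default.
Qed.

(* A path in a rim hook cannot pass from row i to row i+1 unless the two rows
   share a column, and the absence of 2x2 squares forbids more than one. *)
Lemma rim_hook_bead t k la mu : 0 < t -> is_partition la -> size la <= k ->
  remove_rim_hook t la mu ->
  [/\ is_partition mu, size mu <= k
    & exists2 x, t <= x & perm_eq (x :: betas k mu) (x - t :: betas k la)].
Proof.
move=> t0 pl lk [pm ml sm conn no22].
have mk : size mu <= k by apply: leq_trans (sub_partition_size pm ml) lk.
split=> //; have sl := is_partition_sorted pl; have smu := is_partition_sorted pm.
pose d i := nth 0 mu i < nth 0 la i.
have dk i : d i -> i < k.
  by rewrite /d => H; rewrite ltnNge; apply/negP => ki; move: H;
    rewrite [nth 0 la i]nth_default ?(leq_trans lk).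
have exd : exists i, d i.
  have [//|nd] := pselect (exists i, d i).
  have : sumn la <= sumn mu.
    rewrite !(@sumn_nth _ k) //; apply: leq_sum => i _; rewrite leqNgt; apply/negP => di.
    by apply: nd; exists (i : nat).
  lia.
have [p dp pmin] := ex_minnP exd.
have [q dq qmax] := ex_maxnP exd (fun i di => ltnW (dk i di)).
have pq : p <= q by exact: pmin.
have Sp : in_diagram la (p, nth 0 mu p) && ~~ in_diagram mu (p, nth 0 mu p).
  by rewrite !in_diagramE ltnn; apply/andP.
have Sq : in_diagram la (q, nth 0 mu q) && ~~ in_diagram mu (q, nth 0 mu q).
  by rewrite !in_diagramE ltnn; apply/andP.
have overlap i : p <= i < q -> nth 0 mu i < nth 0 la i.+1.
  move=> /andP[pi iq]; rewrite ltnNge; apply/negP => li.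
  have [s [Ss ps ls]] := conn _ _ Sp Sq.
  have {ls} : (last (p, nth 0 mu p) s).1 = q by rewrite ls.
  suff H c : c.1 <= i -> in_diagram la c && ~~ in_diagram mu c -> all (fun c =>
    in_diagram la c && ~~ in_diagram mu c) s -> path cell_adj c s -> (last c s).1 <= i.
    by move=> lq; have := H (p, nth 0 mu p) pi Sp Ss ps; rewrite lq leqNgt iq.
  elim: s c {Ss ps Sp Sq} => //= c' s IH c ci Sc /andP[Sc' Ss] /andP[cc' ps].
  apply: IH => //; case: c c' ci Sc Sc' cc' {ps Ss} => [c1 c2] [e1 e2] /= ci.
  rewrite !in_diagramE /cell_adj /= -!leqNgt => /andP[h1 h2] /andP[h3 h4] H.
  rewrite leqNgt; apply/negP => ie.
  have [cE [eE eqc]] : c1 = i /\ e1 = i.+1 /\ c2 = e2 by move: H; lia.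
  by subst; lia.
clear conn Sp Sq.
have shape i : p <= i < q -> nth 0 mu i = (nth 0 la i.+1).-1.
  move=> piq; have ov := overlap i piq.
  have [|le1] := leqP (nth 0 la i.+1) (nth 0 mu i).+1.
    by move: ov; case: (nth 0 la i.+1) => //= u; rewrite !ltnS => mu_le le_mu; apply/eqP;
      rewrite eqn_leq mu_le le_mu.
  have l1 := nth_sorted_geq sl (leqnSn i); have m1 := nth_sorted_geq smu (leqnSn i).
  by exfalso; apply: (no22 i (nth 0 mu i)); clear no22; split; rewrite !in_diagramE; lia.
clear no22; have qk := dk _ dq.
have out i : i < k -> (i < p) || (q < i) -> bead k mu i = bead k la i.
  move=> ik ipq; rewrite /bead; congr addn; apply/eqP; rewrite eqn_leq ml leqNgt; apply/negP => di.
  by have := pmin _ di; have := qmax _ di; lia.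
have inn i : p <= i < q -> bead k mu i = bead k la i.+1.
  by move=> piq; have := overlap i piq; rewrite /bead shape //; lia.
have P := betas_shift pq qk out inn (erefl _).
(* Comparing the sums of the beads shows that the bead has moved by exactly [t]. *)
have := perm_sumn P; rewrite /= !sumn_betas // sm => E.
have xt : bead k la p = bead k mu q + t by lia.
exists (bead k la p); first by rewrite xt leq_addl.
by rewrite {2}xt addnK.
Qed.

Definition conn (S : pred (nat * nat)) c d :=
  exists p : seq (nat * nat), [/\ all S p, path cell_adj c p & last c p = d].

Lemma conn_trans (S : pred (nat * nat)) c d e : conn S c d -> conn S d e -> conn S c e.
Proof.
move=> [p [Sp pp <-]] [r [Sr pr <-]]; exists (p ++ r).
by rewrite all_cat Sp Sr cat_path pp pr last_cat.
Qed.

Lemma cell_adj_sym c d : cell_adj c d = cell_adj d c.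
Proof. by rewrite /cell_adj; lia. Qed.

Lemma conn_sym (S : pred (nat * nat)) c d : S c -> conn S c d -> conn S d c.
Proof.
move=> Sc [p [Sp pp <-]]; elim: p c Sc Sp pp => [|x p IH] c Sc /=; first by exists [::].
move=> /andP[Sx Sp] /andP[cx pp]; apply: conn_trans (IH x Sx Sp pp) _.
by exists [:: c]; rewrite /= Sc cell_adj_sym cx.
Qed.

Lemma bead_rim_hook t k la x : 0 < t -> is_partition la -> size la <= k ->
  x \in betas k la -> t <= x -> x - t \notin betas k la ->
  exists mu, remove_rim_hook t la mu.
Proof.
move=> t0 pl lk /betasP[p pk ->] tx; set y := _ - t => yB.
have sl := is_partition_sorted pl.
have [kr br _] := nonbead_col pl yB; set r := count _ _ in kr br.
have rk : r <= k by rewrite -[k in _ <= k](size_mkseq (bead k la)) count_size.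
have pr : p < r by rewrite -br // /y; lia.
have ynb i : i < k -> y != bead k la i by move=> ik; apply: contra yB => /eqP ->; apply/betasP;
  exists i.
pose q := r.-1.
have qk : q < k by rewrite /q; lia.
have pq : p <= q by rewrite /q; lia.
have yq : y < bead k la q by rewrite br // /q; lia.
have yq1 : q.+1 < k -> bead k la q.+1 < y.
  by move=> qk1; have := br _ qk1; have := ynb _ qk1; rewrite /q prednK ?ltnn; lia.
have kq : k - q.+1 <= y by rewrite /q; lia.
(* Rows after the move: [q] is the last row with its bead above [y]; rows [p] to [q - 1] take the
   bead of the next row, hence one cell less than that row, and row [q] takes the bead [y]. *)
pose m i := if (p <= i) && (i < q) then (nth 0 la i.+1).-1
  else if i == q then y - (k - q.+1) else nth 0 la i.
have mono i : nth 0 la i.+1 <= nth 0 la i by exact: nth_sorted_geq.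
have laq i : i <= q -> 0 < nth 0 la i.
  move=> iq; have := nth_sorted_geq sl iq; move: yq kq; rewrite /bead; lia.
have mq : m q < nth 0 la q by move: yq kq; rewrite /m ltnn andbF eqxx /bead; lia.
have mE i : p <= i < q -> m i = (nth 0 la i.+1).-1 by rewrite /m => ->.
have mo i : (i < p) || (q < i) -> m i = nth 0 la i.
  by rewrite /m => H; rewrite !ifF //; lia.
have mlt i : p <= i <= q -> m i < nth 0 la i.
  move=> piq; have [->//|iq] := eqVneq i q.
  by rewrite mE; have := laq i.+1; have := mono i; lia.
have mle i : m i <= nth 0 la i.
  have [piq|npiq] := boolP (p <= i <= q); first exact/ltnW/mlt.
  by rewrite mo //; lia.
have sm : sorted geq (mkseq m k).
  apply: sorted_mkseq => i ik /=.
  have [piq|npiq] := boolP (p <= i < q).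
    by rewrite [m i]mE //; have := mlt i.+1; lia.
  have [iq|iq] := eqVneq i q.
    subst i; rewrite mo ?ltnSn ?orbT // /m ltnn andbF eqxx.
    by have := yq1 ik; rewrite /bead; lia.
  by rewrite [m i]mo ?(leq_trans (mle _)) //; lia.
have [pm nm] := filter_pos_sorted sm; set mu := [seq z <- _ | _] in pm nm.
have nmu i : i < k -> nth 0 mu i = m i by move=> ik; rewrite nm nth_mkseq.
have nmu' i : k <= i -> nth 0 mu i = 0 by move=> ki; rewrite nm nth_default // size_mkseq.
have muE i : nth 0 mu i = m i.
  have [|ki] := ltnP i k; first exact: nmu.
  by rewrite nmu' // mo ?nth_default ?(leq_trans lk) //; lia.
have mule i : nth 0 mu i <= nth 0 la i by rewrite muE.
have mk : size mu <= k by apply: leq_trans (sub_partition_size pm mule) lk.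
have SE i j : in_diagram la (i, j) && ~~ in_diagram mu (i, j) = (m i <= j < nth 0 la i).
  by rewrite !in_diagramE muE -leqNgt andbC.
have rows i j : m i <= j < nth 0 la i -> p <= i <= q.
  move=> mj; have [//|npiq] := boolP (p <= i <= q).
  by move: mj; rewrite mo; lia.
exists mu; split=> //.
- have P : perm_eq (bead k la p :: betas k mu) (y :: betas k la).
    apply: (@betas_shift _ _ _ p q) => // [i ik ipq|i piq|].
    + by rewrite /bead muE mo.
    + by rewrite /bead muE mE //; have := laq i.+1; lia.
    + by rewrite /bead muE /m ltnn andbF eqxx subnK.
  have := perm_sumn P; rewrite /= !sumn_betas // => E.
  by rewrite /y in E; lia.
- set S := fun c => _.
  (* Every cell walks left to the start of its row, which lies above the last cell of the next row,
     and so descends to the start of row [q]. *)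
  have toq : forall c, S c -> conn S c (q, m q).
    move=> [i j]; rewrite /S SE => mj; have := rows i j mj.
    have [n] := ubnP (q - i); elim: n i j mj => // n IHn i j mj qi piq.
    have toleft : conn S (i, j) (i, m i).
      have [e] := ubnP (j - m i); elim: e j mj => // e IHe j mj je.
      have [jm|jm] := eqVneq j (m i); first by rewrite jm; exists [::].
      apply: (@conn_trans _ _ (i, j.-1)); last by apply: IHe; lia.
      by exists [:: (i, j.-1)]; rewrite /= /S SE /cell_adj /=; split=> //; lia.
    apply: conn_trans toleft _; have [iq|iq] := eqVneq i q; first by rewrite iq; exists [::].
    have H1 : m i.+1 <= m i < nth 0 la i.+1.
      by rewrite [m i]mE; have := mlt i.+1; have := laq i.+1; lia.
    apply: (@conn_trans _ _ (i.+1, m i)); last by apply: IHn => //; lia.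
    by exists [:: (i.+1, m i)]; rewrite /= /S SE /cell_adj /=; split=> //; lia.
  move=> c d Sc Sd; apply: conn_trans (toq c Sc) _; apply: conn_sym => //; exact: toq.
- move=> i j []; rewrite !SE => h1 _ _ h2.
  by have := rows _ _ h1; have := rows _ _ h2 => r2 r1; rewrite mE in h1; lia.
Qed.

(** * Runners *)

Definition runner t (B : seq nat) c := count (fun x => x %% t == c) B.

Lemma rim_reach_runner t k la sg : 0 < t -> rim_reach t la sg -> is_partition la -> size la <= k ->
  [/\ is_partition sg, size sg <= k & forall c, runner t (betas k la) c = runner t (betas k sg) c].
Proof.
move=> t0; elim=> {la sg} [la|la mu nu step _ IH] pl lk; first by split.
have [pm mk [x tx /permP px]] := rim_hook_bead t0 pl lk step.
have [pn nk En] := IH pm mk; split=> // c; rewrite -En.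
have := px (fun x => x %% t == c); rewrite /= -{1}(subnK tx) modnDr; rewrite /runner; lia.
Qed.

Lemma down_closed_mem s q : uniq s -> (forall q, q.+1 \in s -> q \in s) -> (q \in s) = (q < size s).
Proof.
move=> us ds; have down i j : i <= j -> j \in s -> i \in s.
  by elim: j => [|j IH]; [rewrite leqn0 => /eqP ->|rewrite leq_eqVlt ltnS =>
    /orP[/eqP ->//|/IH h /ds]].
apply/idP/idP => [qs|].
  rewrite -(size_iota 0 q.+1); apply: uniq_leq_size; first exact: iota_uniq.
  by move=> i; rewrite mem_iota ltnS => /down; apply.
apply: contraTT => qs; rewrite -leqNgt -(size_iota 0 q); apply: uniq_leq_size => // j js.
by rewrite mem_iota /= add0n ltnNge; apply/negP => qj; rewrite (down q j) in qs.
Qed.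

Definition flush t (B : seq nat) := forall x, x \in B -> t <= x -> x - t \in B.

(** The occupied levels [x %/ t] of a runner form an initial segment, so the runner counts determine
    a flush set. *)
Lemma flush_mem t B y : 0 < t -> uniq B -> flush t B ->
  (y \in B) = (y %/ t < runner t B (y %% t)).
Proof.
move=> t0 uB fB; pose s := [seq x %/ t | x <- B & x %% t == y %% t].
have us : uniq s.
  rewrite map_inj_in_uniq ?filter_uniq // => u v;
    rewrite !mem_filter => /andP[/eqP mu _] /andP[/eqP mv _] E.
  by rewrite (divn_eq u t) (divn_eq v t) E mu mv.
have mem q : (q \in s) = (q * t + y %% t \in B).
  apply/mapP/idP => [[x]|H].
    by rewrite mem_filter => /andP[/eqP <- xB] ->; rewrite -divn_eq.
  exists (q * t + y %% t); first by rewrite mem_filter modnMDl modn_mod eqxx.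
  by rewrite divnMDl // divn_small ?addn0 // ltn_mod.
rewrite {1}(divn_eq y t) -mem down_closed_mem //; first by rewrite size_map size_filter.
move=> q; rewrite !mem => /fB; rewrite mulSn -addnA addKn; apply; exact: leq_addr.
Qed.

Lemma runner_out t B c : 0 < t -> t <= c -> runner t B c = 0.
Proof.
move=> t0 tc; apply/eqP; rewrite -leqn0 leqNgt -has_count; apply/hasPn => x _.
by apply/eqP => E; have := ltn_pmod x t0; rewrite E ltnNge tc.
Qed.

(** Each removal lowers [sumn] and preserves the runner counts. When no bead can move, the bead set
    is flush, and the counts identify it with that of [sg]. *)
Lemma runner_core_of t k la sg : 0 < t -> is_partition la -> size la <= k -> is_core t sg ->
  size sg <= k ->
  (forall c, runner t (betas k la) c = runner t (betas k sg) c) -> is_core_of t la sg.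
Proof.
move=> t0 pl lk csg sk; have psg := csg.1.
have [n] := ubnP (sumn la); elim: n la pl lk => // n IH la pl lk ln E.
have [fl|nfl] := pselect (flush t (betas k la)).
  suff -> : la = sg by split=> //; exact: rim_reach_refl.
  apply: (@betas_inj k) => // y.
  rewrite (flush_mem y t0 (betas_uniq k pl) fl) E -flush_mem //; first exact: betas_uniq.
  by move/is_core_betas: csg; apply.
have [x [xB tx xt]] : exists x, [/\ x \in betas k la, t <= x & x - t \notin betas k la].
  have [//|nx] := pselect (exists x, [/\ x \in betas k la, t <= x & x - t \notin betas k la]).
  case: nfl => x xB tx; have [//|H] := boolP (x - t \in _).
  by case: nx; exists x.
have [mu step] := bead_rim_hook t0 pl lk xB tx xt.
have [pm mk [z tz /permP pz]] := rim_hook_bead t0 pl lk step.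
have [||] := IH mu pm mk.
- by have [_ _ E' _ _] := step; lia.
- move=> c; rewrite -E; have := pz (fun x => x %% t == c).
  by rewrite /= -{1}(subnK tz) modnDr /runner; lia.
by move=> r _; split=> //; apply: rim_reach_step step r.
Qed.

Lemma count_residue_split (P : pred nat) d u c B : 0 < d -> c < d -> (forall y,
  P y -> y %% d = c) ->
  \sum_(j < u.+1) count (fun y => P y && (y %% (d * u.+1) == c + d * j)) B = count P B.
Proof.
move=> d0 cd Pd; elim: B => [|y B IH] /=; first by rewrite big1.
rewrite big_split /= IH; congr addn; case: (boolP (P y)) => [Py|_]; last by rewrite big1.
set r := y %% (d * u.+1).
have rd : r %% d = c by rewrite -(Pd _ Py) /r modn_dvdm // dvdn_mulr.
have ju : r %/ d < u.+1 by rewrite ltn_divLR // mulnC ltn_mod muln_gt0 d0.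
rewrite (bigD1 (Ordinal ju)) //= big1 ?addn0 => [|j jr].
  by rewrite {1}(divn_eq r d) rd addnC mulnC eqxx.
apply/eqP; rewrite eqb0; apply: contra jr => /eqP E; apply/eqP/val_inj => /=.
by rewrite E divnDr ?dvdn_mulr // divn_small // mulKn.
Qed.

Lemma size_runner t B : 0 < t -> size B = \sum_(c < t) runner t B c.
Proof.
move=> t0; elim: B => [|y B IH] /=; first by rewrite big1.
rewrite /runner /= big_split /= -IH -add1n; congr addn.
have yt : y %% t < t by rewrite ltn_mod.
rewrite (bigD1 (Ordinal yt)) //= eqxx big1 // => j jy; apply/eqP; rewrite eqb0.
by apply: contra jy => /eqP E; apply/eqP/val_inj.
Qed.

Lemma betasS k la : size la <= k -> betas k.+1 la = rcons (map S (betas k la)) 0.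
Proof.
move=> lk; rewrite /betas /mkseq -addn1 iotaD map_cat /= add0n cats1 -map_comp; congr rcons.
  by apply/eq_in_map => i; rewrite mem_iota /bead /=; lia.
by rewrite /bead nth_default // addn1 subnn.
Qed.

Lemma count_betasD k la j (P : pred nat) : size la <= k ->
  count P (betas (k + j) la) = count (fun x => P (x + j)) (betas k la) + count P (iota 0 j).
Proof.
move=> lk; elim: j P => [|j IH] P.
  by rewrite !addn0; apply: eq_count => x; rewrite addn0.
rewrite addnS betasS ?(leq_trans lk) ?leq_addr // -cats1 count_cat count_map IH /=.
rewrite -[iota 1 j]/(iota (1 + 0) j) iotaDl count_map.
rewrite addn0 addnAC -addnA; congr addn.
by apply: eq_count => x /=; rewrite addnS.
Qed.

(** Padding with zero parts shifts the old beads by a multiple of [t], which keeps their residues,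
    and the new beads below [n * t] put [n] on each runner. *)
Lemma runner_betasD t k la n c : 0 < t -> c < t -> size la <= k ->
  runner t (betas (k + n * t) la) c = runner t (betas k la) c + n.
Proof.
move=> t0 ct lk; rewrite /runner count_betasD //; congr addn.
  by apply: eq_count => x; rewrite addnC modnMDl.
elim: n => // n IH; rewrite mulSn addnC iotaD count_cat IH add0n -[RHS]addn1; congr addn.
rewrite -[n * t]addn0 iotaDl count_map (eq_in_count (a2 := pred1 c)).
  by rewrite count_uniq_mem ?iota_uniq // mem_iota ct.
by move=> x; rewrite mem_iota /= => xt; rewrite modnMDl modn_small.
Qed.

Lemma betas_of_runners t k (x : nat -> nat) : 0 < t -> \sum_(c < t) x c = k ->
  exists la, [/\ is_partition la, size la <= k, flush t (betas k la)
    & forall c, c < t -> runner t (betas k la) c = x c].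
Proof.
(* Each [x c] is at most [k], so the range below [t * k] contains all the beads wanted. *)
move=> t0 xk; pose B := [seq y <- iota 0 (t * k) | y %/ t < x (y %% t)].
have uB : uniq B by rewrite filter_uniq ?iota_uniq.
have memB y : (y \in B) = (y %/ t < x (y %% t)).
  rewrite mem_filter mem_iota add0n /=; case: ltnP => //= yx.
  have yt : y %% t < t by rewrite ltn_mod.
  have xl : x (y %% t) <= k by rewrite -xk (bigD1 (Ordinal yt)) //= leq_addr.
  by rewrite mulnC -ltn_divLR // (leq_trans yx xl).
have fB : flush t B.
  move=> y; rewrite !memB => yx ty; have yE : y = y - t + t by rewrite subnK.
  rewrite {1}yE divnDr ?dvdnn // divnn t0 in yx.
  rewrite {2}yE modnDr in yx; lia.
have rB c : c < t -> runner t B c = x c.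
  move=> ct; apply/eqP; rewrite eqn_leq; apply/andP; split; rewrite leqNgt; apply/negP => H.
    have := flush_mem (x c * t + c) t0 uB fB;
      rewrite memB divnMDl // modnMDl modn_small // divn_small // addn0.
    by rewrite H ltnn.
  have := flush_mem (runner t B c * t + c) t0 uB fB;
    rewrite memB divnMDl // modnMDl modn_small // divn_small // addn0.
  by rewrite H ltnn.
pose B' := sort geq B.
have pB : perm_eq B' B by rewrite perm_sort.
have sB' : sorted gtn B'.
  rewrite gtn_sorted_uniq_geq sort_uniq uB sort_sorted //; by move=> u v; exact: leq_total.
have sk : size B' = k.
  by rewrite (perm_size pB) (size_runner B t0) -xk; apply: eq_bigr => c _; rewrite rB.
have [la [pl lk lB]] := betas_surj sB' sk.
exists la; rewrite lB; split=> //.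
  by move=> y; rewrite !(perm_mem pB); exact: fB.
by move=> c ct; rewrite -rB // /runner; apply/permP.
Qed.

Lemma eqmod_lcm s t x y : (x == y %[mod lcmn s t]) = (x == y %[mod s]) && (x == y %[mod t]).
Proof.
wlog xy : x y / y <= x => [H|]; last by rewrite !eqn_mod_dvd // dvdn_lcm.
by case/orP: (leq_total x y) => xy; last exact: H; rewrite ![x %% _ == _]eq_sym H.
Qed.

(** The moduli share the factor [d]; for residues that agree modulo [d] the Chinese remainder
    theorem applies to the quotients, whose moduli are coprime. *)
Lemma residue_exists d a b c i j : 0 < d -> coprime a.+1 b.+1 -> c < d -> i < b.+1 -> j < a.+1 ->
  exists x, x %% (d * b.+1) = c + d * i /\ x %% (d * a.+1) = c + d * j.
Proof.
move=> d0 ab cd ib ja; pose r := chinese b.+1 a.+1 i j.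
have res u w : w < u.+1 -> r = w %[mod u.+1] -> (c + d * r) %% (d * u.+1) = c + d * w.
  move=> wu rw; rewrite -modnDmr -muln_modr rw (modn_small wu) modn_small //.
  apply: (@leq_trans (d * w.+1)); first by rewrite mulnS ltn_add2r.
  by rewrite leq_mul2l wu orbT.
exists (c + d * r); split; apply: res => //.
  by apply: chinese_modl; rewrite coprime_sym.
by apply: chinese_modr; rewrite coprime_sym.
Qed.

(** * Counting cores *)

(** For the class [c] modulo d, rows index the residues modulo t and columns those modulo s, so that
    row and column sums are runner counts for t and s. *)
Definition resmx d a b (B : seq nat) c : 'M[nat]_(b.+1, a.+1) :=
  (\matrix_(i, j) count (fun y => (y %% (d * b.+1) == c + d * i)%N && (y %% (d * a.+1) == c + d *
    j)%N) B)%R.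

Lemma residue_mod d u c i y : c < d -> y %% (d * u) = c + d * i -> y %% d = c.
Proof.
move=> cd E; rewrite -(modn_dvdm y (dvdn_mulr u (dvdnn d))) E.
by rewrite -modnDmr modnMr addn0 modn_small.
Qed.

Lemma resmx_rows d a b B c (i : 'I_b.+1) : c < d ->
  \sum_j resmx d a b B c i j = runner (d * b.+1) B (c + d * i).
Proof.
move=> cd; have d0 : 0 < d by exact: leq_trans cd.
rewrite /runner -(@count_residue_split (fun y => y %% (d * b.+1) == c + d * i) d a c B) //.
  by apply: eq_bigr => j _; rewrite mxE.
by move=> y /eqP; apply: residue_mod.
Qed.

Lemma resmx_cols d a b B c (j : 'I_a.+1) : c < d ->
  \sum_i resmx d a b B c i j = runner (d * a.+1) B (c + d * j).
Proof.
move=> cd; have d0 : 0 < d by exact: leq_trans cd.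
rewrite /runner -(@count_residue_split (fun y => y %% (d * a.+1) == c + d * j) d b c B) //.
  by apply: eq_bigr => i _; rewrite mxE; apply: eq_count => y; rewrite andbC.
by move=> y /eqP; apply: residue_mod.
Qed.

Lemma runner_split d u B c : c < d ->
  \sum_(i < u.+1) runner (d * u.+1) B (c + d * i) = runner d B c.
Proof.
move=> cd; have d0 : 0 < d by exact: leq_trans cd.
rewrite /runner -(@count_residue_split (fun y => y %% d == c) d u c B) //; last by move=> y /eqP.
apply: eq_bigr => i _; apply: eq_count => y; case: eqP => //= [/(residue_mod cd) ->|];
  by rewrite ?eqxx ?andbF.
Qed.

Lemma residue_eq d u y : 0 < d -> y %% (d * u.+1) = y %% d + d * (y %% (d * u.+1) %/ d).
Proof.
move=> d0; rewrite {1}(divn_eq (y %% (d * u.+1)) d) modn_dvdm ?dvdn_mulr //.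
by rewrite addnC mulnC.
Qed.

Lemma residue_lt d u y : 0 < d -> y %% (d * u.+1) %/ d < u.+1.
Proof. by move=> d0; rewrite ltn_divLR // mulnC ltn_mod muln_gt0 d0. Qed.

Lemma runner_lcm d a b B c (i : 'I_b.+1) (j : 'I_a.+1) y :
  y %% (d * b.+1) = c + d * i -> y %% (d * a.+1) = c + d * j ->
  runner (lcmn (d * a.+1) (d * b.+1)) B (y %% lcmn (d * a.+1) (d * b.+1)) = resmx d a b B c i j.
Proof.
move=> yi yj; rewrite mxE /runner; apply: eq_count => x.
by rewrite eqmod_lcm yi yj andbC.
Qed.

Lemma is_core_of_runner t k la sg : 0 < t -> is_partition la -> size la <= k ->
  is_core_of t la sg -> forall c, runner t (betas k la) c = runner t (betas k sg) c.
Proof. by move=> t0 pl lk [r _]; have [] := rim_reach_runner t0 r pl lk. Qed.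

Theorem cores_hascard d a b sg tu k (f : 'I_d -> nat) (s := d * a.+1) (t := d * b.+1) :
  0 < d -> coprime a.+1 b.+1 -> is_core s sg -> is_core t tu -> size sg <= k -> size tu <= k ->
  (forall c : 'I_d, hascard (fun M : 'M[nat]_(b.+1, a.+1) =>
    (forall i, \sum_j M i j = runner t (betas k tu) (c + d * i)) /\
    (forall j, \sum_i M i j = runner s (betas k sg) (c + d * j))) (f c)) ->
  hascard (fun la => [/\ is_core (lcmn s t) la, is_core_of s la sg,
    is_core_of t la tu & size la <= k])
    (\prod_c f c).
Proof.
move=> d0 ab csg ctu sk tk fP; set m := lcmn s t.
have s0 : 0 < s by rewrite muln_gt0 d0.
have t0 : 0 < t by rewrite muln_gt0 d0.
have m0 : 0 < m by rewrite lcmn_gt0 s0.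
pose F la : {ffun 'I_d -> 'M[nat]_(b.+1, a.+1)} := [ffun c : 'I_d => resmx d a b (betas k la) c].
apply: (@hascard_preim _ _ _ _ F) (hascard_family fP).
- move=> la [cla cs ct lk] c; have pl := cla.1; rewrite ffunE; split=> [i|j].
    by rewrite resmx_rows // (is_core_of_runner t0 pl lk ct).
  by rewrite resmx_cols // (is_core_of_runner s0 pl lk cs).
- move=> la mu [cla _ _ lk] [cmu _ _ mk] /ffunP E.
  have pl := cla.1; have pm := cmu.1; apply: (@betas_inj k) => // y.
  have fl : flush m (betas k la) by apply/(is_core_betas m0 pl lk).
  have fm : flush m (betas k mu) by apply/(is_core_betas m0 pm mk).
  rewrite (flush_mem y m0 (betas_uniq k pl) fl) (flush_mem y m0 (betas_uniq k pm) fm).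
  pose i := Ordinal (residue_lt b y d0); pose j := Ordinal (residue_lt a y d0).
  rewrite !(@runner_lcm d a b _ (y %% d) i j); try exact: residue_eq.
  by have := E (Ordinal (ltn_pmod y d0)); rewrite !ffunE => ->.
move=> g gP.
(* Surjectivity: the given matrices are reassembled into runner counts modulo [m]; both quotients
   are in range by [residue_lt], so [inord] is harmless. *)
pose x r := g (Ordinal (ltn_pmod r d0)) (inord (r %% t %/ d)) (inord (r %% s %/ d)).
have [la [pl lk fl lx]] := betas_of_runners m0 (erefl (\sum_(r < m) x r)).
set k' := \sum_(r < m) x r in lk fl lx; set B := betas k' la in fl lx.
have BE (c : 'I_d) : resmx d a b B c = g c.
  apply/matrixP => i j.
  have [y [yi yj]] := residue_exists d0 ab (ltn_ord c) (ltn_ord i) (ltn_ord j).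
  have ym u : u.+1 %| lcmn a.+1 b.+1 -> y %% m %% (d * u.+1) = y %% (d * u.+1).
    by move=> H; rewrite modn_dvdm // /m /s /t -muln_lcmr dvdn_pmul2l.
  rewrite -(runner_lcm B yi yj) lx ?ltn_mod // /x.
  have yd : y %% m %% d = c.
    rewrite modn_dvdm; first exact: residue_mod yi.
    by rewrite /m (dvdn_trans _ (dvdn_lcml _ _)) ?dvdn_mulr.
  have div u : (c + d * u) %/ d = u by rewrite addnC mulnC divnMDl // divn_small ?addn0.
  rewrite /s /t !ym ?dvdn_lcml ?dvdn_lcmr // yi yj !div !inord_val.
  by congr (g _ _ _); apply: val_inj.
have rows q : q < t -> runner t B q = runner t (betas k tu) q.
  move=> qt; have qE := residue_eq b q d0; rewrite -/t modn_small // in qE.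
  have ib : q %/ d < b.+1 by rewrite ltn_divLR // mulnC.
  rewrite qE -[q %/ d]/(nat_of_ord (Ordinal ib)) -(@resmx_rows d a b) ?ltn_mod //.
  have [gr _] := gP (Ordinal (ltn_pmod q d0)).
  by rewrite -[q %% d]/(nat_of_ord (Ordinal (ltn_pmod q d0))) -gr BE.
have cols q : q < s -> runner s B q = runner s (betas k sg) q.
  move=> qs; have qE := residue_eq a q d0; rewrite -/s modn_small // in qE.
  have ja : q %/ d < a.+1 by rewrite ltn_divLR // mulnC.
  rewrite qE -[q %/ d]/(nat_of_ord (Ordinal ja)) -(@resmx_cols d a b) ?ltn_mod //.
  have [_ gc] := gP (Ordinal (ltn_pmod q d0)).
  by rewrite -[q %% d]/(nat_of_ord (Ordinal (ltn_pmod q d0))) -gc BE.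
(* The number of beads [k'] came from the matrices; it is [k] since the runner counts for t agree
   with those of [tu] and add up to the number of beads. *)
have kE : k' = k.
  rewrite -[LHS](size_mkseq (bead k' la)) -[RHS](size_mkseq (bead k tu)).
  by rewrite !(size_runner _ t0); apply: eq_bigr => q _; apply: rows.
rewrite {}/B {k'}kE in lk fl lx BE rows cols.
exists la; last by apply/ffunP => c; rewrite ffunE BE.
split=> //.
- by apply/(is_core_betas m0 pl lk).
- apply: runner_core_of csg sk _ => // q.
  by have [/cols//|sq] := ltnP q s; rewrite !runner_out.
- apply: runner_core_of ctu tk _ => // q.
  by have [/rows//|tq] := ltnP q t; rewrite !runner_out.
Qed.

Lemma Posz_subDn (x u v : nat) : u <= v -> (Posz x - Posz u + Posz v = Posz (x + (v - u)))%R.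
Proof. lia. Qed.

Lemma lcmn_scaled d a b : 0 < d -> coprime a b -> lcmn (d * a) (d * b) = d * a * b.
Proof.
move=> d0 ab; rewrite -muln_lcmr -mulnA; congr muln.
by have := muln_lcm_gcd a b; rewrite (eqP ab) muln1.
Qed.

Lemma gcdn_factor s t : 0 < s -> 0 < t ->
  exists d a b, [/\ 0 < d, coprime a.+1 b.+1, gcdn s t = d, s = d * a.+1 & t = d * b.+1].
Proof.
move=> s0 t0; set d := gcdn s t.
have d0 : 0 < d by rewrite gcdn_gt0 s0.
have sE : d * (s %/ d) = s by rewrite mulnC divnK // dvdn_gcdl.
have tE : d * (t %/ d) = t by rewrite mulnC divnK // dvdn_gcdr.
have a0 : 0 < s %/ d by have := s0; rewrite -{1}sE muln_gt0 => /andP[].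
have b0 : 0 < t %/ d by have := t0; rewrite -{1}tE muln_gt0 => /andP[].
exists d, (s %/ d).-1, (t %/ d).-1; rewrite !prednK //; split=> //.
rewrite /coprime -(eqn_pmul2l d0) muln1; apply/eqP.
by rewrite muln_gcdr sE tE.
Qed.

(* Going from k to k + m adds a.+1 beads to every residue class modulo t and b.+1
   to every class modulo s, so that in each block c < d the margins move along a
   ray. *)
Lemma cores_polynomial (R : realType) d a b sg tu rho i (s := d * a.+1) (t := d * b.+1) :
  0 < d -> coprime a.+1 b.+1 -> is_core s sg -> is_core t tu ->
  is_core_of d sg rho -> is_core_of d tu rho ->
  exists P : {poly rat}, [/\ size P = (d * (b * a)).+1,
    ratr (lead_coef P) = (fine (transport_volume R a b) ^+ d)%R
    & exists K, forall n, K <= n -> exists2 N,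
        hascard (fun la => [/\ is_core (lcmn s t) la, is_core_of s la sg, is_core_of t la tu
                             & size la <= i + n * lcmn s t]) N
        & (N%:R = P.[n%:R])%R].
Proof.
move=> d0 ab csg ctu rsg rtu; set m := lcmn s t.
have s0 : 0 < s by rewrite muln_gt0 d0.
have t0 : 0 < t by rewrite muln_gt0 d0.
have mE : m = d * a.+1 * b.+1 by exact: lcmn_scaled.
have m0 : 0 < m by rewrite lcmn_gt0 s0.
(* With fewer beads than parts, [betas] would truncate. The counts are taken at [kb], which is large
   enough, and the offsets go back [k0] periods so that [n] keeps its meaning. *)
pose k0 := maxn (size sg) (size tu); pose kb := i + k0 * m.
have kbk : k0 <= kb by rewrite /kb (leq_trans (leq_pmulr _ m0)) ?leq_addl.
have sk : size sg <= kb by exact: leq_trans (leq_maxl _ _) kbk.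
have tk : size tu <= kb by exact: leq_trans (leq_maxr _ _) kbk.
pose A c (j : 'I_b.+1) := (Posz (runner t (betas kb tu) (c + d * j)) - Posz (k0 * a.+1))%R.
pose B c (j : 'I_a.+1) := (Posz (runner s (betas kb sg) (c + d * j)) - Posz (k0 * b.+1))%R.
(* Before the common shift both totals are the number of beads in the class [c] modulo d, read off
   the common d-core [rho]. *)
have AB (c : 'I_d) : (\sum_j A c j = \sum_j B c j)%R.
  rewrite !sumrB -!sum_Posz !sum_nat_const !card_ord !runner_split //.
  rewrite (is_core_of_runner d0 csg.1 sk rsg) (is_core_of_runner d0 ctu.1 tk rtu).
  by rewrite mulnCA [a.+1 * _]mulnCA [b.+1 * _]mulnC.
have /choice[f fP] (c : 'I_d) : exists f, forall n, hascard (margins (A c) (B c) n) (f n).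
  by have /choice[f fP] n := @margins_hascard _ _ (A c) (B c) n; exists f.
have /choice[p pP] c := margins_quasipoly R (AB c) (fP c).
have {pP} /choice[N NP] c := pP c.
have p0 c : p c != 0%R by have [_ sp _] := NP c; rewrite -size_poly_eq0 sp.
exists (\prod_c p c)%R; split.
- rewrite size_prod //; under eq_bigr => c _ do have [_ -> _] := NP c.
  by rewrite sum_nat_const cardT size_enum_ord mulnS addnC -addSn addnK.
- rewrite lead_coef_prod rmorph_prod /=; under eq_bigr => c _ do have [_ _ ->] := NP c.
  by rewrite prodr_const card_ord.
exists (k0 + \sum_c N c) => n nK; have nk0 : k0 <= n by exact: leq_trans (leq_addr _ _) nK.
have kE : i + n * m = kb + (n - k0) * m by rewrite /kb -addnA -mulnDl subnKC.
have rt q : q < t -> runner t (betas (i + n * m) tu) q = runner t (betas kb tu) q + (n - k0) * a.+1.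
  move=> qt; rewrite kE -(runner_betasD (t := t)) //; congr (runner _ (betas (_ + _) _) _).
  by rewrite mE /t -!mulnA; congr muln; rewrite mulnCA.
have rs q : q < s -> runner s (betas (i + n * m) sg) q = runner s (betas kb sg) q + (n - k0) * b.+1.
  move=> qs; rewrite kE -(runner_betasD (t := s)) //; congr (runner _ (betas (_ + _) _) _).
  by rewrite mE /s -!mulnA; congr muln; rewrite [RHS]mulnC mulnA.
have res u c (j : 'I_u.+1) : c < d -> c + d * j < d * u.+1.
  by move=> cd; apply: (@leq_trans (d * j.+1)); rewrite ?leq_pmul2l // mulnS ltn_add2r.
exists (\prod_c f c n).
  apply: cores_hascard => //; try by rewrite kE (leq_trans _ (leq_addr _ _)).
  have ka : k0 * a.+1 <= n * a.+1 by rewrite leq_mul2r nk0 orbT.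
  have kb' : k0 * b.+1 <= n * b.+1 by rewrite leq_mul2r nk0 orbT.
  move=> c; apply: hascard_ext (fP c n) => M; split=> -[Mr Mc]; split=> j.
  - by apply/eqP; rewrite -eqz_nat Mr rt ?res // mulnBl /A Posz_subDn.
  - by apply/eqP; rewrite -eqz_nat Mc rs ?res // mulnBl /B Posz_subDn.
  - by rewrite Mr rt ?res // mulnBl /A Posz_subDn.
  - by rewrite Mc rs ?res // mulnBl /B Posz_subDn.
rewrite natr_prod horner_prod; apply: eq_bigr => c _; have [pc _ _] := NP c.
by apply: pc; apply: leq_trans nK; rewrite (bigD1 c) //= addnCA leq_addr.
Qed.

Theorem theorem3 (R : realType) (s t : nat) (sigma tau : seq nat) :
  0 < s -> 0 < t ->
  is_core s sigma -> is_core t tau ->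
  (exists rho, is_core_of (gcdn s t) sigma rho /\ is_core_of (gcdn s t) tau rho) ->
  exists (Q : nat -> rat),
    quasipoly_lead Q (lcmn s t) ((s - gcdn s t) * (t - gcdn s t) %/ gcdn s t)
      ((Vtransport R (s %/ gcdn s t) (t %/ gcdn s t)) ^+ gcdn s t)%R /\
    exists K : nat, forall k : nat, K <= k ->
      card_is (fun la => [/\ is_core (lcmn s t) la,
                             is_core_of s la sigma,
                             is_core_of t la tau
                           & plength la <= k])
              (Q k).
Proof.
move=> s0 t0; have m0 : 0 < lcmn s t by rewrite lcmn_gt0 s0.
have [d [a [b [d0 ab gE sE tE]]]] := gcdn_factor s0 t0.
rewrite gE => csg ctu [rho [rsg rtu]].
set m := lcmn s t in m0 *; rewrite {1}sE in csg; rewrite {1}tE in ctu.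
have /choice[P PP] i := cores_polynomial R i d0 ab csg ctu rsg rtu.
rewrite -sE -tE -/m in PP.
have /choice[K KP] i : exists K, forall n, K <= n -> exists2 N,
    hascard (fun la => [/\ is_core m la, is_core_of s la sigma, is_core_of t la tau
                         & size la <= i + n * m]) N
    & (N%:R = (P i).[n%:R])%R.
  by have [_ _] := PP i.
exists (fun k => (P (k %% m)%N).[(k %/ m)%N%:R])%R; split.
  move=> i im; have [sP lP _] := PP i; exists (P i); split.
  - rewrite sP sE tE -[X in _ - X]muln1 -mulnBr -[X in d * b.+1 - X]muln1 -mulnBr !subn1 /=.
    by rewrite -mulnA mulKn // [in RHS]mulnCA [a * b]mulnC.
  - by rewrite lP {1}sE {1}tE !mulKn.
  - move=> n; rewrite addnC modnMDl modn_small // divnMDl // divn_small // addn0.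
    by [].
(* One threshold for all residues: beyond it [k %/ m] is at least every [K i]. *)
exists ((\sum_(i < m) K i) * m) => k kK.
have km : k %% m < m by rewrite ltn_mod.
have [|N [l [ul lP sl]] NE] := KP (k %% m) (k %/ m).
  rewrite leq_divRL //; apply: leq_trans kK; rewrite leq_mul2r; apply/orP; right.
  by rewrite (bigD1 (Ordinal km)) //= leq_addr.
exists l; split=> [//|x|]; last by rewrite sl NE.
by rewrite lP [k %% m + _]addnC -divn_eq.
Qed.
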